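(* Let $\Omega\subseteq\mathbb{R}^n$ be a bounded, smooth domain with closure $\overline{\Omega}$, and let the sequence $(p_i)_{i\ge1}\subset C(\overline{\Omega})$ decrease uniformly to $p$. Let $\varphi\in W^{1,p_1}(\Omega)$ and $f\in\left(W_0^{1,p}(\Omega)\right)^{\ast}$. Denote by $w$ and $w_i$ the unique solutions of the Dirichlet problem for Poisson's equation with right-hand side $f$ and boundary datum $\varphi$, with exponent $p$ and $p_i$, respectively. Assume $1<p_-$, $p_+<\infty$, and that for some $J\in\mathbb{N}$ it holds that $\int_\Omega|\nabla w|^{p_J}dx<\infty$. Then $$\int_\Omega|\nabla(w_i-w)|^p\,dx\to 0\quad\text{as } i\to\infty.$$
   Context: For a measurable exponent $q:\Omega\to(1,\infty)$ with $1<q_-=\inf_\Omega q\le q_+=\sup_\Omega q<\infty$ ($q$ abbreviates $q(x)$): $L^{q}(\Omega)$ is the space of measurable $g$ with $\int_\Omega|\lambda g(x)|^{q(x)}dx<\infty$ for some $\lambda>0$, with Luxemburg norm $\|g\|_q=\inf\{\lambda>0:\int_\Omega(|g(x)|/\lambda)^{q(x)}dx\le 1\}$. $W^{1,q}(\Omega)$ is the space of $g\in L^q(\Omega)$ whose weak gradient satisfies $|\nabla g|\in L^q(\Omega)$ ($|\cdot|$ the Euclidean norm), with norm $\|g\|_{1,q}=\|g\|_q+\||\nabla g|\|_q$. $W^{1,q}_0(\Omega)$ is the closure of $C_0^\infty(\Omega)$ in $W^{1,q}(\Omega)$. $X^{\ast}$ is the dual of the Banach space $X$ and $\langle f,x\rangle$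 is the action of $f\in X^{\ast}$ on $x\in X$. If $q\le r$ on the bounded set $\Omega$, then $W^{1,r}(\Omega)\hookrightarrow W^{1,q}(\Omega)$ and $W_0^{1,r}(\Omega)\hookrightarrow W_0^{1,q}(\Omega)$ continuously, so an element of $(W_0^{1,q}(\Omega))^{\ast}$ is also regarded, by restriction, as an element of $(W_0^{1,r}(\Omega))^{\ast}$. Solution of the Dirichlet problem for Poisson's equation with exponent $q$, right-hand side $f\in (W^{1,q}_0(\Omega))^{\ast}$ and boundary datum $\varphi\in W^{1,q}(\Omega)$: formally $\Delta_q w=\mathrm{div}(|\nabla w|^{q-2}\nabla w)=f$ in $\Omega$, $w|_{\partial\Omega}=\varphi$. A function $w\in W^{1,q}(\Omega)$ is a (weak) solution if $w-\varphi\in W^{1,q}_0(\Omega)$ and $-\int_\Omega|\nabla w|^{q-2}\nabla w\cdot\nabla h\,dx=\langle f,h\rangle$ for every $h\in C_0^\infty(\Omega)$. For $q\in C(\overline\Omega)$ with $1<q_-\le q_+<\infty$ it is known that a solution exists and is unique. ''$(p_i)$ decreases uniformly to $p$'' means $p_{i+1}\le p_i$ on $\Omega$ for all $i$ and $p_i\to p$ uniformly in $\Omega$. *)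

(* Defs.v *)
From HB Require Import structures.
From mathcomp Require Import all_boot all_order all_algebra.
From mathcomp Require Import all_classical all_reals all_analysis.

Set Implicit Arguments.
Unset Strict Implicit.
Unset Printing Implicit Defensive.

Import Order.TTheory GRing.Theory Num.Def Num.Theory.
Import numFieldTopology.Exports numFieldNormedType.Exports.

Local Open Scope classical_set_scope.
Local Open Scope ring_scope.

(* 'rV[R]_n carries the sigma-algebra generated by the coordinates, i.e. the
   product (= Borel) sigma-algebra, exactly as n.-tuple R does in the library. *)
Section measurable_rV.
Context {R : realType}.
Variable n : nat.

Let coor : 'I_n -> 'rV[R]_n -> R := fun i v => v ord0 i.

Let rV_set0 : g_sigma_preimage coor set0.
Proof. exact: sigma_algebra0. Qed.

Let rV_setC A : g_sigma_preimage coor A -> g_sigma_preimage coor (~` A).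
Proof. exact: sigma_algebraC. Qed.

Let rV_bigcup (F : _^nat) : (forall i, g_sigma_preimage coor (F i)) ->
  g_sigma_preimage coor (\bigcup_i (F i)).
Proof. exact: sigma_algebra_bigcup. Qed.

HB.instance Definition _ :=
  @isMeasurable.Build (measure_tuple_display default_measure_display)
    'rV[R]_n (g_sigma_preimage coor) rV_set0 rV_setC rV_bigcup.

End measurable_rV.

Section measurable_rV_lemmas.
Context {R : realType}.

Lemma measurable_coor n (i : 'I_n) :
  measurable_fun [set: 'rV[R]_n] (fun v : 'rV[R]_n => v ord0 i).
Proof.
move=> _ Y mY; rewrite setTI; apply: sub_sigma_algebra => /=.
rewrite -bigcup_seq/=; exists i => /=; first by rewrite mem_index_enum.
by exists Y => //; rewrite setTI.
Qed.

Lemma measurable_fun_rV d (T : measurableType d) n (f : T -> 'rV[R]_n) :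
  (forall i, measurable_fun [set: T] (fun x => f x ord0 i)) ->
  measurable_fun [set: T] f.
Proof.
move=> mf _ A mA; rewrite setTI.
pose P := [set B : set 'rV[R]_n | measurable (f @^-1` B)].
suff : P A by [].
move: A mA; apply: smallest_sub.
  split=> /= [|B mB|F mF]; rewrite /P/=.
  - by rewrite preimage_set0.
  - by rewrite setTD -preimage_setC; exact: measurableC.
  - by rewrite preimage_bigcup; exact: bigcupT_measurable.
rewrite -bigcup_seq/=; apply: bigcup_sub => i _ _ [B mB <-].
by rewrite /P/= setTI; have := mf i measurableT B mB; rewrite setTI.
Qed.

Definition cons_rV n (xv : R * 'rV[R]_n) : 'rV[R]_n.+1 :=
  row_mx (\row_(j < 1) xv.1) xv.2.

Lemma measurable_cons_rV n : measurable_fun setT (@cons_rV n).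
Proof.
apply: measurable_fun_rV => i; rewrite /cons_rV.
case: (@split_ordP 1 n i) => j ->.
  rewrite (_ : (fun _ => _) = fst); first exact: measurable_fst.
  by apply/funext => xv; apply: etrans (row_mxEl _ _ _ _) _; rewrite mxE.
rewrite (_ : (fun _ => _) = (fun v : 'rV[R]_n => v ord0 j) \o snd).
  by apply: measurableT_comp (measurable_coor j) _; exact: measurable_snd.
by apply/funext => xv; exact: row_mxEr.
Qed.

Lemma measurable_behead_rV n :
  measurable_fun [set: 'rV[R]_n.+1] (fun v => rsubmx (v : 'rV[R]_(1 + n))).
Proof.
apply: measurable_fun_rV => i.
rewrite (_ : (fun _ => _) = (fun v : 'rV[R]_n.+1 => v ord0 (rshift 1 i))).
  exact: (@measurable_coor n.+1).
by apply/funext => v; rewrite mxE.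
Qed.

End measurable_rV_lemmas.

(* The image of (Lebesgue on R) \x mu under R * R^n ~ R^n.+1. *)
Section lebesgue_rV_succ.
Context {R : realType}.
Variables (n : nat) (mu : {sigma_finite_measure set 'rV[R]_n -> \bar R}).
Local Open Scope ereal_scope.

Definition lebesgue_rV_succ : set 'rV[R]_n.+1 -> \bar R :=
  pushforward (@lebesgue_measure R \x mu) (@cons_rV R n).

Let push : {measure set 'rV[R]_n.+1 -> \bar R} :=
  measure_function_pushforward__canonical__measure_function_Measure
    (@lebesgue_measure R \x mu) (@measurable_cons_rV R n).

Let succ0 : lebesgue_rV_succ set0 = 0.
Proof. exact: (measure0 push). Qed.

Let succ_ge0 A : 0 <= lebesgue_rV_succ A.
Proof. exact: (measure_ge0 push). Qed.

Let succ_sigma_additive : semi_sigma_additive lebesgue_rV_succ.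
Proof. exact: (@measure_semi_sigma_additive _ _ _ push). Qed.

HB.instance Definition _ := isMeasure.Build _ _ _ lebesgue_rV_succ
  succ0 succ_ge0 succ_sigma_additive.

Let succ_sigma_finite : sigma_finite setT lebesgue_rV_succ.
Proof.
have /sigma_finiteP[F [TF ndF Foo]] := sigma_finiteT (@lebesgue_measure R).
have /sigma_finiteP[G [TG ndG Goo]] := sigma_finiteT mu.
pose g (v : 'rV[R]_n.+1) : measurableTypeR R * 'rV[R]_n :=
  (v ord0 ord0, rsubmx (v : 'rV[R]_(1 + n))).
have mg : measurable_fun setT g.
  by apply/measurable_fun_pairP; split;
    [exact: (@measurable_coor R n.+1 ord0)|exact: measurable_behead_rV].
have gK : cancel (@cons_rV R n) g.
  case=> x v; rewrite /g /cons_rV; congr pair; last by rewrite row_mxKr.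
  have -> : ord0 = lshift n (ord0 : 'I_1) :> 'I_(1 + n) by exact/val_inj.
  by apply: etrans (row_mxEl _ _ _ _) _; rewrite mxE.
exists (fun k => g @^-1` (F k `*` G k)).
  rewrite -preimage_bigcup; apply/seteqP; split=> // v _.
  have [i _ Fi] : (\bigcup_i F i) (g v).1 by rewrite -TF.
  have [j _ Gj] : (\bigcup_i G i) (g v).2 by rewrite -TG.
  exists (maxn i j) => //; split.
  - by move: Fi; exact/subsetPset/ndF/leq_maxl.
  - by move: Gj; exact/subsetPset/ndG/leq_maxr.
move=> k; have [mF Fk] := Foo k; have [mG Gk] := Goo k; split.
  by rewrite -[X in measurable X]setTI; apply: mg => //; exact: measurableX.
rewrite /lebesgue_rV_succ /pushforward -comp_preimage.
rewrite (_ : g \o _ = id); last by apply/funext => x; exact: gK.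
by rewrite /= product_measure1E// lte_mul_pinfty// ge0_fin_numE.
Qed.

HB.instance Definition _ := Measure_isSigmaFinite.Build _ _ _ lebesgue_rV_succ
  succ_sigma_finite.

End lebesgue_rV_succ.

(* Lebesgue measure on R^n, as the iterated product of the one on R. *)
Fixpoint lebesgue_rV {R : realType} (n : nat) :
    {sigma_finite_measure set 'rV[R]_n -> \bar R} :=
  match n with
  | 0 => dirac (0 : 'rV[R]_0)
  | n'.+1 => lebesgue_rV_succ (lebesgue_rV n')
  end.

Lemma lebesgue_rV_box {R : realType} (n : nat) (A : 'I_n -> set R) :
  (forall i, measurable (A i)) ->
  lebesgue_rV n [set v : 'rV[R]_n | forall i, A i (v ord0 i)] =
  (\prod_(i < n) lebesgue_measure (A i))%E.
Proof.
elim: n A => [|n IH] A mA.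
  rewrite big_ord0 /= diracE mem_set//=.
  by case.
rewrite big_ord_recl -(IH (fun i => A (lift ord0 i)))//.
rewrite /= /lebesgue_rV_succ /pushforward.
rewrite (_ : _ @^-1` _ =
    A ord0 `*` [set v : 'rV[R]_n | forall i, A (lift ord0 i) (v ord0 i)]).
  apply: product_measure1E; first exact: mA.
  have -> : [set v : 'rV[R]_n | forall i : 'I_n, A (lift ord0 i) (v ord0 i)] =
      \bigcap_(i in [set: 'I_n])
        ((fun v : 'rV[R]_n => v ord0 i) @^-1` A (lift ord0 i)).
    by apply/seteqP; split=> [v Av i _|v Av i]; exact: Av.
  apply: fin_bigcap_measurable => // i _; rewrite -[X in measurable X]setTI.
  exact: measurable_coor.
have cons0 x v : @cons_rV R n (x, v) ord0 ord0 = x.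
  have -> : ord0 = lshift n (ord0 : 'I_1) :> 'I_(1 + n) by exact/val_inj.
  by apply: etrans (row_mxEl _ _ _ _) _; rewrite mxE.
have consS x v i : @cons_rV R n (x, v) ord0 (lift ord0 i) = v ord0 i.
  have -> : lift ord0 i = rshift 1 i :> 'I_(1 + n) by exact/val_inj.
  exact: row_mxEr.
apply/seteqP; split=> [[x v] /= H|[x v] /= [H1 H2] i].
  split=> [|i]; first by have := H ord0; rewrite cons0.
  by have := H (lift ord0 i); rewrite consS.
by case: (unliftP ord0 i) => [j|] ->; rewrite ?consS ?cons0.
Qed.

(* The norm of the library on 'rV[R]_n is the sup norm: topologically
   irrelevant, but |grad u| below is Euclidean. *)
Definition dotV {R : realType} {n : nat} (u v : 'rV[R]_n) : R :=
  \sum_(i < n) u ord0 i * v ord0 i.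

Definition enorm {R : realType} {n : nat} (v : 'rV[R]_n) : R :=
  Num.sqrt (dotV v v).

Section smooth.
Context {R : realType} {n : nat}.
Implicit Types (h : 'rV[R]_n -> R) (Omega : set 'rV[R]_n).

Definition partial (i : 'I_n) h : 'rV[R]_n -> R := 'D_(delta_mx ord0 i) h.

Definition grad h (x : 'rV[R]_n) : 'rV[R]_n := \row_(i < n) partial i h x.

(* C^oo on R^n: every iterated partial derivative exists and is continuous. *)
Definition smooth h : Prop := forall s : seq 'I_n,
  let g := foldr partial h s in
  continuous g /\ forall i x, derivable g x (delta_mx ord0 i).

Definition test_fun Omega h : Prop :=
  [/\ smooth h, compact (closure [set x | h x != 0]) &
      closure [set x | h x != 0] `<=` Omega].

(* Each boundary point has a smooth local defining function. *)
Definition smooth_boundary Omega : Prop :=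
  forall x, closure Omega x -> ~ Omega x ->
  exists rho, [/\ smooth rho, grad rho x != 0 &
    \forall y \near x, Omega y <-> rho y < 0].

Definition bounded_smooth_domain Omega : Prop :=
  [/\ open Omega, connected Omega, Omega !=set0, bounded_set Omega &
      smooth_boundary Omega].

End smooth.

(* Elements of the function spaces are represented by functions on R^n of which
   only the values on Omega matter; they are not quotiented by a.e. equality. *)
Section sobolev.
Context {R : realType} {n : nat}.
Variable Omega : set 'rV[R]_n.
Implicit Types (q g u v w phi : 'rV[R]_n -> R).
Local Notation mu := (lebesgue_rV n).

Definition modular q g : \bar R :=
  (\int[mu]_(x in Omega) (`|g x| `^ q x)%:E)%E.

Definition Lq q g : Prop :=
  measurable_fun Omega g /\
  exists2 l : R, 0 < l & (modular q (fun x => l * g x)%R < +oo)%E.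

Definition Lq_norm q g : \bar R :=
  ereal_inf [set l%:E | l in
    [set l : R | 0 < l /\ (modular q (fun x => g x / l)%R <= 1)%E]].

Definition loc_integrable g : Prop :=
  measurable_fun Omega g /\
  forall K, compact K -> K `<=` Omega -> mu.-integrable K (EFin \o g).

Definition is_weak_grad u (G : 'rV[R]_n -> 'rV[R]_n) : Prop :=
  loc_integrable u /\
  forall i, loc_integrable (fun x => G x ord0 i) /\
    forall h, test_fun Omega h ->
      (\int[mu]_(x in Omega) (u x * partial i h x)) =
      - (\int[mu]_(x in Omega) (G x ord0 i * h x)).

(* A representative of the weak gradient (junk when there is none). *)
Definition wgrad u : 'rV[R]_n -> 'rV[R]_n := xget (fun=> 0) (is_weak_grad u).

Definition W1 q u : Prop :=
  [/\ Lq q u, exists G, is_weak_grad u G & Lq q (fun x => enorm (wgrad u x))].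

Definition W1_norm q u : \bar R :=
  (Lq_norm q u + Lq_norm q (fun x => enorm (wgrad u x)))%E.

Definition W10 q u : Prop :=
  W1 q u /\ forall e : R, 0 < e ->
    exists2 h, test_fun Omega h & (W1_norm q (u \- h)%R < e%:E)%E.

(* f is (the restriction to W10 q of) a bounded linear functional. *)
Definition W10_dual q (f : ('rV[R]_n -> R) -> R) : Prop :=
  (forall (a : R) u v, W10 q u -> W10 q v ->
     f (fun x => a * u x + v x) = a * f u + f v) /\
  exists C : R, forall u, W10 q u -> (`|f u|%:E <= C%:E * W1_norm q u)%E.

Definition dirichlet_solution q (f : ('rV[R]_n -> R) -> R) phi w : Prop :=
  [/\ W1 q w, W10 q (w \- phi) &
    forall h, test_fun Omega h ->
      - (\int[mu]_(x in Omega)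
          (enorm (wgrad w x) `^ (q x - 2) * dotV (wgrad w x) (grad h x)))
      = f h].

End sobolev.

(* Main.v *)
Require Import Defs.
From HB Require Import structures.
From mathcomp Require Import all_boot all_order all_algebra.
From mathcomp Require Import all_classical all_reals all_analysis.
From mathcomp Require Import measurable_realfun ring lra.

Import Order.TTheory GRing.Theory Num.Def Num.Theory.
Import numFieldTopology.Exports numFieldNormedType.Exports.

Set Implicit Arguments.
Unset Strict Implicit.
Unset Printing Implicit Defensive.

Local Open Scope classical_set_scope.
Local Open Scope ring_scope.

(** The solutions minimize convex energies, and the proof compares energies.
    The obvious competitor for [w_ i] would be [w], but [w - phi] is a limit of
    test functions in the norm of the exponent [p], and for exponents that are
    merely continuous it need not be one in the stronger norm of [p_ i]. The
    competitor used here is [phi + h] with [h] a test function such that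
    [phi + h] is close to [w] for the exponent [p]. It is admissible for all [i]
    at once, and along this fixed function the energy of exponent [p_ i] tends
    to that of exponent [p] by dominated convergence
    ([Rintegral_exponent_gap_cvg0]).

    Let [D_W(X)], called [bregman p W X] below, be the Bregman distance of
    [|.|^p / p] from [W = grad w]. Convexity of [|.|^q / q] with [q = p_ i] at
    [V = grad (w_ i)], and monotonicity of [(s^q - 1) / q] in [q], bound
    [D_W(V)] pointwise by the sum of [D_W(grad (phi + h))], of an exponent gap
    that vanishes in the limit, and of the difference of the fluxes of [w] and
    [w_ i] applied to [grad (phi + h - w_ i)] ([bregman_competitor]). The two
    equations have the same right-hand side, so their fluxes agree on gradients
    of test functions, hence by density on [grad (phi + h - w_ i)]
    ([flux_eq_closure]), and the last summand integrates to [0]. Therefore the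
    upper limit of the integrals of [D_W(V)] is at most the integral of
    [D_W(grad (phi + h))], which is small by [bregman_le]. Uniform convexity,
    with constants that do not depend on the exponent as long as it stays in a
    compact subset of the half-line above [1] ([powR_enormB_le]), converts this
    into the smallness of the integral of [|V - W|^p] ([energy_convergence]).

    It remains to relate the weak gradient of [w_ i - w] to those of [w_ i] and
    [w], and that of [w - phi - h] to [grad h]. Weak gradients are unique almost
    everywhere by the fundamental lemma of the calculus of variations
    ([du_bois_reymond]), for which smooth bumps converging to indicators of
    boxes are built from [exp(-1/x)]; and the gradient of a test function is a
    weak gradient by integration by parts ([test_fun_is_weak_grad]), obtained
    from Fubini's theorem and the one-dimensional fundamental theorem of
    calculus. *)

(** * Inequalities for real powers *)

Section power_inequalities.
Context {R : realType}.
Implicit Types (a p q s t : R).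

Lemma bernoulli_powR p s : 1 <= p -> 0 <= s -> 1 + p * (s - 1) <= s `^ p.
Proof.
rewrite le_eqVlt => /orP[/eqP <- s0|p1 s0].
  by rewrite powRr1//; lra.
have p0 : 0 < p by lra.
have p'0 : 0 < p / (p - 1) by rewrite divr_gt0//; lra.
have := @conjugate_powR R s 1 p (p / (p - 1)) s0 ler01 p0 p'0.
have -> : p^-1 + (p / (p - 1))^-1 = 1.
  by field; rewrite !gt_eqF//; lra.
move=> /(_ erefl); rewrite mulr1 powR1 => h.
have {h} : p * s <= p * (s `^ p / p + 1 / (p / (p - 1))) by rewrite ler_pM2l.
rewrite (_ : p * (_ + _) = s `^ p + (p - 1)); first by lra.
by field; rewrite !gt_eqF//; lra.
Qed.

Lemma powR_tangent p s t : 1 <= p -> 0 <= s -> 0 < t ->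
  t `^ p + p * t `^ (p - 1) * (s - t) <= s `^ p.
Proof.
move=> p1 s0 t0.
have st0 : 0 <= s / t by rewrite divr_ge0// ltW.
have := bernoulli_powR p1 st0.
rewrite -(@ler_pM2l _ (t `^ p)) ?powR_gt0// -(powRM _ (ltW t0) st0).
rewrite (_ : t * (s / t) = s); last by rewrite mulrCA divff ?gt_eqF// mulr1.
apply: le_trans.
rewrite -(@mulr_powRB1 _ t p) ?(ltW t0)//; last by lra.
rewrite le_eqVlt; apply/orP; left; apply/eqP; field.
by rewrite gt_eqF.
Qed.

(** Bernoulli's inequality for the exponent [q / p] and the base [s `^ p]. *)
Lemma powR_exponent_mono p q s : 1 <= p -> p <= q -> 0 <= s ->
  (s `^ p - 1) / p <= (s `^ q - 1) / q.
Proof.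
move=> p1 pq s0.
have p0 : 0 < p by lra.
have q0 : 0 < q by lra.
have qp1 : 1 <= q / p by rewrite ler_pdivlMr// mul1r.
have := bernoulli_powR qp1 (powR_ge0 s p).
rewrite -powRrM mulrCA divff ?gt_eqF// mulr1 => h.
rewrite ler_pdivlMr//; apply: le_trans (_ : q / p * (s `^ p - 1) <= _).
  by rewrite le_eqVlt; apply/orP; left; apply/eqP; field; rewrite gt_eqF.
by lra.
Qed.

(** Strictness in Bernoulli's inequality: [s^((1+p)/2)] is the geometric mean
    of [s] and [s^p], so it lies strictly below their arithmetic mean, while
    Bernoulli already holds for the exponent [(1+p)/2]. *)
Lemma bernoulli_powR_lt p s : 1 < p -> 0 < s -> s != 1 ->
  1 + p * (s - 1) < s `^ p.
Proof.
move=> p1 s0 s1.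
pose r := (1 + p) / 2.
have r1 : 1 <= r by rewrite /r; lra.
have := bernoulli_powR r1 (ltW s0).
have Er : s `^ r = s `^ (2^-1) * s `^ (p / 2).
  rewrite -powRD; first by congr powR; rewrite /r; lra.
  by rewrite (gt_eqF s0) implybT.
have E1 : s = s `^ (2^-1) ^+ 2.
  by rewrite powR12_sqrt ?sqr_sqrtr ?ltW.
have Ep : s `^ p = s `^ (p / 2) ^+ 2.
  by rewrite -powR_mulrn ?powR_ge0// -powRrM mulfVK.
have : 0 < (s `^ (2^-1) - s `^ (p / 2)) ^+ 2.
  rewrite exprn_even_gt0//= subr_eq0; apply/eqP => h.
  have : s `^ p = s by rewrite Ep -h -E1.
  move/(congr1 (@ln R)); rewrite ln_powR => /eqP.
  rewrite -subr_eq0 -{2}[ln s]mul1r -mulrBl mulf_eq0 subr_eq0 (gt_eqF p1)/=.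
  by rewrite ln_eq0// (negbTE s1).
rewrite sqrrB -Ep -E1 -Er /r => + h.
by set X := s `^ ((1 + p) / 2) in h *; lra.
Qed.

(** The deficit in Young's inequality for the conjugate pair [s], [1]. *)
Definition young_gap p s := (s `^ p - 1) / p - (s - 1).

Lemma young_gap_mono p q s : 1 <= p -> p <= q -> 0 <= s ->
  young_gap p s <= young_gap q s.
Proof. by move=> p1 pq s0; rewrite lerB// powR_exponent_mono. Qed.

Lemma young_gap_ge0 p s : 1 <= p -> 0 <= s -> 0 <= young_gap p s.
Proof.
move=> p1 s0; apply: le_trans (young_gap_mono (lexx 1) p1 s0).
by rewrite /young_gap powRr1// divr1 subrr.
Qed.

Lemma young_gap_gt0 p s : 1 < p -> 0 < s -> s != 1 -> 0 < young_gap p s.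
Proof.
move=> p1 s0 s1; have := bernoulli_powR_lt p1 s0 s1.
rewrite /young_gap subr_gt0 ltr_pdivlMr; last by lra.
by lra.
Qed.

Lemma young_gap_tangent p s t : 1 <= p -> 0 <= s -> 0 < t ->
  young_gap p t + (t `^ (p - 1) - 1) * (s - t) <= young_gap p s.
Proof.
move=> p1 s0 t0; have := powR_tangent p1 s0 t0; rewrite /young_gap => h.
have p0 : 0 < p by lra.
rewrite -(@ler_pM2r _ p)//.
rewrite [X in X <= _](_ : _ = t `^ p + p * t `^ (p - 1) * (s - t)
  - 1 - p * (s - 1)); last by field; rewrite gt_eqF.
rewrite [X in _ <= X](_ : _ = s `^ p - 1 - p * (s - 1)); first by lra.
by field; rewrite gt_eqF.
Qed.

Lemma powR_le1 s p : 0 <= s -> s <= 1 -> 0 <= p -> s `^ p <= 1.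
Proof.
move=> s0 s1 p0; have := @ge0_ler_powR R p p0 s 1.
by rewrite !nnegrE powR1; apply.
Qed.

Lemma powR_ge1 s p : 1 <= s -> 0 <= p -> 1 <= s `^ p.
Proof.
move=> s1 p0; have := @ge0_ler_powR R p p0 1 s.
by rewrite !nnegrE powR1; apply => //; lra.
Qed.

Lemma powR_le_exponent s p q : 0 <= s -> 0 < p -> p <= q ->
  s `^ p <= 1 + s `^ q.
Proof.
move=> s0 p0 pq; have [s1|/ltW s1] := leP s 1.
  by apply: (le_trans (powR_le1 s0 s1 (ltW p0))); rewrite lerDl powR_ge0.
by apply: le_trans (ler_powR s1 pq) _; rewrite lerDr.
Qed.

(** The product is at most the [p]-th power of the larger of [s] and [t]. *)
Lemma powR_mixed p s t : 1 <= p -> 0 <= s -> 0 <= t ->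
  s `^ (p - 1) * t <= s `^ p + t `^ p.
Proof.
move=> p1 s0 t0; have p0 : 0 < p by lra.
have [st|/ltW ts] := leP s t.
  apply: le_trans (_ : t `^ p <= _); last by rewrite lerDr powR_ge0.
  rewrite -(mulr_powRB1 t0 p0) mulrC ler_wpM2l// ge0_ler_powR ?nnegrE//; lra.
apply: le_trans (_ : s `^ p <= _); last by rewrite lerDl powR_ge0.
by rewrite -(mulr_powRB1 s0 p0) mulrC ler_wpM2r// powR_ge0.
Qed.

Lemma powR_add1_le p s : 1 <= p -> 0 <= s ->
  (s + 1) `^ p <= 2 `^ p * (s `^ p + 1).
Proof.
move=> p1 s0; have p0 : 0 <= p by lra.
have s10 : 0 <= s + 1 by lra.
have [s1|s1] := leP s 1.
  apply: (@le_trans _ _ (2 `^ p)).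
    by rewrite ge0_ler_powR// ?nnegrE; lra.
  by rewrite ler_peMr ?powR_ge0// lerDr powR_ge0.
apply: (@le_trans _ _ ((2 * s) `^ p)).
  by rewrite ge0_ler_powR// ?nnegrE; lra.
by rewrite powRM// ler_wpM2l ?powR_ge0// lerDl.
Qed.

(** The tangent lines at [1 + e] and [1 - e] have a positive and a negative slope,
    so the gap increases on the right of [1] and decreases on its left. *)
Lemma young_gap_away p e s : 1 < p -> 0 < e -> e < 1 -> 0 <= s ->
  e ^+ 2 <= (s - 1) ^+ 2 ->
  minr (young_gap p (1 + e)) (young_gap p (1 - e)) <= young_gap p s.
Proof.
move=> p1 e0 e1 s0 es; have p10 : 0 <= p - 1 by lra.
rewrite ge_min; apply/orP; have [s1|s1] := leP 1 s; [left|right].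
  have e10 : 0 < 1 + e by lra.
  have {}es : e <= s - 1.
    by move: es; rewrite ler_pXn2r ?nnegrE ?subr_ge0// ltW.
  apply: le_trans (young_gap_tangent (ltW p1) s0 e10).
  rewrite lerDl mulr_ge0 ?subr_ge0 ?powR_ge1//; clear -e0 es; lra.
have e10 : 0 < 1 - e by lra.
have {}es : e <= 1 - s.
  move: es; rewrite -[(s - 1) ^+ 2]sqrrN opprB.
  by rewrite ler_pXn2r ?nnegrE ?subr_ge0// ltW.
apply: le_trans (young_gap_tangent (ltW p1) s0 e10).
rewrite lerDl mulr_le0 ?subr_le0 ?powR_le1//; clear -e0 e1 es; lra.
Qed.

(** The gap is superlinear, being above its tangent line at [2], hence it
    controls [s] and therefore [s^p], which is linear in the gap and [s]. *)
Lemma powR_le_young_gap a b p s : 1 < a -> a <= p -> p <= b -> 0 <= s ->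
  s `^ p + 1 <=
    b * young_gap p s + b * (1 + young_gap p s / (2 `^ (a - 1) - 1)) + 2.
Proof.
move=> a1 ap pb s0; set k := _ - 1.
have p1 : 1 <= p by lra.
have p0 : 0 < p by lra.
have k0 : 0 < k.
  have a10 : 0 < a - 1 by lra.
  have := @gt0_ltr_powR R (a - 1) a10 1 2; rewrite !nnegrE powR1 /k.
  by move=> /(_ ler01 (ler0n _ 2) (ltr1n _ 2)); lra.
have Es : s `^ p + 1 = p * young_gap p s + (p * (s - 1) + 2).
  by rewrite /young_gap; field; rewrite gt_eqF.
have D0 := young_gap_ge0 p1 s0.
have sD : s <= 2 + young_gap p s / k.
  rewrite -lerBlDl ler_pdivlMr// mulrC.
  apply: le_trans (young_gap_mono (ltW a1) ap s0).
  apply: le_trans (@young_gap_tangent a s 2 (ltW a1) s0 (ltr0n _ 2)).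
  by rewrite lerDr young_gap_ge0// ltW.
rewrite Es addrA lerD2r lerD ?ler_wpM2r//.
have Dk : 0 <= young_gap p s / k by rewrite divr_ge0// ltW.
move: Dk sD; set x := young_gap p s / k; clear -p0 pb => Dk sD.
by nra.
Qed.

(** Uniform convexity of [s^p], uniformly for exponents [p] in [[a, b]]: here
    [s] is the ratio of the lengths of two vectors and [m] the loss in the
    Cauchy-Schwarz inequality, so that [(s - 1)^2 + 2m] is their squared
    distance and [young_gap p s + m] their Bregman distance. *)
Lemma young_gap_uniform a b d : 1 < a -> 0 < d -> exists2 C : R, 0 < C &
  forall p s m, a <= p -> p <= b -> 0 <= s -> 0 <= m -> m <= 2 * s ->
  Num.sqrt ((s - 1) ^+ 2 + 2 * m) `^ p <= d + C * (young_gap p s + m).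
Proof.
move=> a1 d0.
pose e := minr d 1.
have e0 : 0 < e by rewrite lt_min d0/=.
have ed : e <= d by rewrite ge_min lexx.
have e1 : e <= 1 by rewrite ge_min lexx orbT.
have e20 : 0 < e / 2 by lra.
have e21 : e / 2 < 1 by lra.
(* lower bound of [young_gap p s + m] where the distance exceeds [e] *)
pose c0 := minr ((e / 2) ^+ 2) (minr (young_gap a (1 + e / 2))
  (young_gap a (1 - e / 2))).
have c00 : 0 < c0.
  rewrite !lt_min; apply/and3P; split; first by rewrite exprn_gt0.
  - by apply: young_gap_gt0 => //; [lra|rewrite gt_eqF//; lra].
  - by apply: young_gap_gt0 => //; [lra|rewrite lt_eqF//; lra].
have [ab|ba] := leP a b; last first.
  exists 1 => // p s m ap pb.
  by have := le_lt_trans (le_trans ap pb) ba; rewrite ltxx.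
have b0 : 0 < b by lra.
pose k : R := 2 `^ (a - 1) - 1.
have k0 : 0 <= k by rewrite subr_ge0 powR_ge1//; lra.
pose C := 2 `^ b * (b + b / k + (b + 2) / c0).
have C0 : 0 < C.
  have b20 : 0 < b + 2 by lra.
  rewrite mulr_gt0 ?powR_gt0// ltr_wpDl ?divr_gt0//.
  by rewrite addr_ge0 ?divr_ge0// ltW.
exists C => // p s m ap pb s0 m0 ms.
have p1 : 1 <= p by clear -a1 ap; lra.
have p0 : 0 <= p by clear -p1; lra.
have gap0 : 0 <= young_gap p s by exact: young_gap_ge0.
set D := young_gap p s + m; set N := Num.sqrt _.
have gD : young_gap p s <= D by rewrite lerDl.
have mD : m <= D by rewrite lerDr.
have aD : young_gap a s <= D.
  by apply: le_trans gD; apply: young_gap_mono => //; exact: ltW.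
have N0 : 0 <= N by exact: sqrtr_ge0.
have N2 : N ^+ 2 = (s - 1) ^+ 2 + 2 * m.
  by rewrite sqr_sqrtr// addr_ge0 ?sqr_ge0// mulr_ge0.
have CD0 : 0 <= C * D.
  by apply: mulr_ge0; [exact: ltW|exact: addr_ge0].
have [Ne|eN] := leP N e.
  apply: le_trans (_ : e <= _); last by rewrite -[leLHS]addr0 lerD.
  apply: le_trans (_ : e `^ p <= _).
    by rewrite ge0_ler_powR// nnegrE ltW.
  by rewrite ge1r_powR// e0.
have c0D : c0 <= D.
  have e2 : e ^+ 2 < (s - 1) ^+ 2 + 2 * m.
    by rewrite -N2 ltr_pXn2r// nnegrE ltW.
  have [me|me] := leP ((e / 2) ^+ 2) m.
    by apply: le_trans mD; rewrite ge_min me.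
  have {}e2 : (e / 2) ^+ 2 <= (s - 1) ^+ 2.
    have := sqr_ge0 e; clear -e2 me; rewrite !expr2 in e2 me *; lra.
  apply: le_trans aD; rewrite ge_min young_gap_away//.
  by rewrite orbT.
have NS : N <= s + 1.
  have s10 : 0 <= s + 1 by rewrite addr_ge0.
  rewrite -(@ler_pXn2r _ 2) ?nnegrE// N2.
  by clear -ms; rewrite !expr2; nra.
apply: le_trans (_ : C * D <= _); last by rewrite lerDr ltW.
apply: (@le_trans _ _ ((s + 1) `^ p)).
  by rewrite ge0_ler_powR// nnegrE addr_ge0.
apply: le_trans (powR_add1_le p1 s0) _.
have D0 : 0 < D by exact: lt_le_trans c0D.
rewrite /C -mulrA; apply: ler_pM; rewrite ?addr_ge0 ?powR_ge0//.
  by rewrite ler_powR// ler1n.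
apply: le_trans (powR_le_young_gap a1 ap pb s0) _; rewrite -/k.
have h1 : b * young_gap p s <= b * D by rewrite ler_wpM2l// ltW.
have h2 : b * (young_gap p s / k) <= b / k * D.
  by rewrite mulrA mulrAC ler_wpM2l// divr_ge0// ltW.
have h3 : b + 2 <= (b + 2) / c0 * D.
  by rewrite mulrAC ler_pdivlMr// ler_wpM2l//; clear -b0; lra.
move: h1 h2 h3; clear.
rewrite !(mulrDl _ _ D) [b * (1 + _)]mulrDr mulr1; lra.
Qed.

End power_inequalities.

(** * Bregman distance of the powers of the Euclidean norm *)

Section euclidean_norm.
Context {R : realType} {n : nat}.
Implicit Types (u v w : 'rV[R]_n).

Lemma dotVC u v : dotV u v = dotV v u.
Proof. by apply: eq_bigr => i _; rewrite mulrC. Qed.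

Lemma dotVDr u v w : dotV u (v + w) = dotV u v + dotV u w.
Proof. by rewrite -big_split; apply: eq_bigr => i _; rewrite mxE mulrDr. Qed.

Lemma dotVZr a u v : dotV u (a *: v) = a * dotV u v.
Proof. by rewrite mulr_sumr; apply: eq_bigr => i _; rewrite mxE mulrCA. Qed.

Lemma dotVNr u v : dotV u (- v) = - dotV u v.
Proof. by rewrite -scaleN1r dotVZr mulN1r. Qed.

Lemma dotVBr u v w : dotV u (v - w) = dotV u v - dotV u w.
Proof. by rewrite dotVDr dotVNr. Qed.

Lemma dotVBl u v w : dotV (u - v) w = dotV u w - dotV v w.
Proof. by rewrite dotVC dotVBr !(dotVC w). Qed.

Lemma dotVv_ge0 u : 0 <= dotV u u.
Proof. by apply: sumr_ge0 => i _; rewrite -expr2 sqr_ge0. Qed.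

Lemma enorm_ge0 u : 0 <= enorm u.
Proof. exact: sqrtr_ge0. Qed.

Lemma sqr_enorm u : enorm u ^+ 2 = dotV u u.
Proof. by rewrite sqr_sqrtr// dotVv_ge0. Qed.

Lemma enorm0 : enorm (0 : 'rV[R]_n) = 0.
Proof.
apply/eqP; rewrite -sqrf_eq0 sqr_enorm; apply/eqP/big1 => i _.
by rewrite mxE mul0r.
Qed.

Lemma enormZ (l : R) u : 0 <= l -> enorm (l *: u) = l * enorm u.
Proof.
move=> l0; rewrite /enorm dotVZr dotVC dotVZr mulrA -expr2.
by rewrite sqrtrM ?sqr_ge0// sqrtr_sqr ger0_norm.
Qed.

Lemma enorm0_eq0 u : enorm u = 0 -> u = 0.
Proof.
move=> u0; have : dotV u u == 0 by rewrite -sqr_enorm u0 expr0n.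
rewrite psumr_eq0 => [/allP u00|i _]; last by rewrite -expr2 sqr_ge0.
apply/rowP => i; rewrite mxE; apply/eqP.
by have := u00 i (mem_index_enum _); rewrite implyTb mulf_eq0 orbb.
Qed.

Lemma sqr_enormB u v :
  enorm (u - v) ^+ 2 = enorm u ^+ 2 - 2 * dotV u v + enorm v ^+ 2.
Proof. by rewrite !sqr_enorm dotVBl !dotVBr (dotVC v u); ring. Qed.

Lemma enormN u : enorm (- u) = enorm u.
Proof. by rewrite /enorm dotVNr dotVC dotVNr opprK. Qed.

(** The Cauchy-Schwarz inequality, from the square of the component of
    [enorm v *: u] that is orthogonal to [v]. *)
Lemma dotV_le u v : dotV u v <= enorm u * enorm v.
Proof.
have [/enorm0_eq0 ->|v0] := eqVneq (enorm v) 0.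
  rewrite (_ : dotV u 0 = 0) ?mulr_ge0 ?enorm_ge0//.
  by apply: big1 => i _; rewrite mxE mulr0.
have {}v0 : 0 < enorm v by rewrite lt_def v0 enorm_ge0.
have := dotVv_ge0 (enorm v *: u - (dotV u v / enorm v) *: v).
rewrite dotVBl !dotVBr !(dotVZr _ _ u) !(dotVZr _ _ v) ![dotV (_ *: _) _]dotVC.
rewrite !dotVZr (dotVC v u) -!sqr_enorm.
set A := enorm u; set B := enorm v in v0 *; set D := dotV u v.
rewrite [X in 0 <= X](_ : _ = (A * B) ^+ 2 - D ^+ 2).
  rewrite subr_ge0 => h.
  rewrite (le_trans (ler_norm D))// -(@ler_pXn2r _ 2) ?nnegrE//.
    by rewrite real_normK ?num_real.
  by rewrite mulr_ge0 ?enorm_ge0.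
by field; rewrite gt_eqF.
Qed.

Lemma dotV_norm_le u v : `|dotV u v| <= enorm u * enorm v.
Proof.
rewrite ler_norml dotV_le andbT lerNl -dotVNr.
by rewrite (le_trans (dotV_le _ _))// enormN.
Qed.

Lemma enormD u v : enorm (u + v) <= enorm u + enorm v.
Proof.
rewrite -(@ler_pXn2r _ 2) ?nnegrE ?addr_ge0 ?enorm_ge0//.
rewrite -[v in enorm (u + v)]opprK sqr_enormB enormN dotVNr.
by have := dotV_le u v; rewrite (sqrrD (enorm u)); lra.
Qed.

End euclidean_norm.

Section bregman.
Context {R : realType} {n : nat}.
Implicit Types (X Y W : 'rV[R]_n) (p q l : R).

(** The pairing of [Y] with the field [|X|^(p-2) X] of the [p]-Laplacian. *)
Definition flux p X Y : R := enorm X `^ (p - 2) * dotV X Y.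

(** Bregman distance of the convex function [|.|^p / p], whose gradient at [W]
    is [|W|^(p-2) W]. *)
Definition bregman p W X : R :=
  (enorm X `^ p - enorm W `^ p) / p - flux p W (X - W).

Lemma fluxBr p X Y W : flux p X (Y - W) = flux p X Y - flux p X W.
Proof. by rewrite /flux dotVBr mulrBr. Qed.

Lemma flux0 p Y : flux p 0 Y = 0.
Proof.
rewrite /flux (_ : dotV 0 Y = 0) ?mulr0//.
by apply: big1 => i _; rewrite mxE mul0r.
Qed.

Lemma flux_norm_le p X Y : `|flux p X Y| <= enorm X `^ (p - 1) * enorm Y.
Proof.
have [/enorm0_eq0 ->|X0] := eqVneq (enorm X) 0.
  by rewrite flux0 normr0 mulr_ge0 ?powR_ge0 ?enorm_ge0.
rewrite normrM ger0_norm ?powR_ge0//.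
rewrite (_ : p - 1 = p - 2 + 1); last by ring.
rewrite (@powRD _ _ (p - 2) 1) ?X0 ?implybT// powRr1 ?enorm_ge0// -mulrA.
by rewrite ler_wpM2l ?powR_ge0// dotV_norm_le.
Qed.

Lemma flux_norm_le_scaled p l X Y : 1 <= p -> 0 < l ->
  `|flux p X Y| <= l * (enorm X `^ p + (enorm Y / l) `^ p).
Proof.
move=> p1 l0; apply: le_trans (flux_norm_le _ _ _) _.
rewrite -[X in _ * X <= _](@mulfVK _ l) ?gt_eqF// [leLHS]mulrA [leLHS]mulrC.
apply: ler_wpM2l; first exact: ltW.
by rewrite powR_mixed ?enorm_ge0// divr_ge0 ?enorm_ge0// ltW.
Qed.

Lemma powR_split2 p (t : R) : t != 0 -> 0 <= t ->
  t `^ p = t `^ (p - 2) * t ^+ 2.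
Proof.
move=> t0 t0'; rewrite -powR_mulrn// -powRD ?t0 ?implybT//.
by congr powR; ring.
Qed.

(** Convexity of [|.|^p / p], whose differential at [X] is [flux p X]. *)
Lemma flux_le_powR p X Y : 1 <= p ->
  flux p X (Y - X) <= (enorm Y `^ p - enorm X `^ p) / p.
Proof.
move=> p1; have p0 : 0 < p by lra.
have [/enorm0_eq0 ->|X0] := eqVneq (enorm X) 0.
  rewrite flux0 enorm0 powR0 ?gt_eqF// subr0.
  by rewrite divr_ge0 ?powR_ge0// ltW.
have X0' := enorm_ge0 X.
have X1 : 0 < enorm X by rewrite lt_def X0.
rewrite ler_pdivlMr// /flux dotVBr -sqr_enorm.
apply: le_trans (_ : enorm X `^ (p - 2) * (enorm X * (enorm Y - enorm X)) * p <= _).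
  rewrite ler_pM2r// ler_wpM2l ?powR_ge0// mulrBr lerB// ?dotV_le//.
rewrite lerBrDl; apply: le_trans (powR_tangent p1 (enorm_ge0 Y) X1).
rewrite lerD2l (_ : p - 1 = p - 2 + 1); last by ring.
rewrite (@powRD _ _ (p - 2) 1) ?X0 ?implybT// powRr1//.
by rewrite le_eqVlt; apply/orP; left; apply/eqP; ring.
Qed.

Lemma bregman_ge0 p W X : 1 <= p -> 0 <= bregman p W X.
Proof. by move=> p1; rewrite subr_ge0 flux_le_powR. Qed.

(** The Bregman distance is at most the monotonicity gap
    [(a(X) - a(W)).(X - W)] of the [p]-Laplacian field [a], which is small
    relative to [|W|^p] when [|X - W|] is small relative to [|W|], and of order
    [|X - W|^p] otherwise. *)
Lemma bregman_le b d : 0 < d -> exists2 C : R, 0 <= C & forall p W X,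
  1 <= p -> p <= b ->
  bregman p W X <= d * enorm W `^ p + C * enorm (X - W) `^ p.
Proof.
move=> d0.
(* [k] separates the two regimes [|X - W| < k |W|] and [|X - W| >= k |W|] *)
have B0 : 0 < 2 `^ b + 1 :> R by rewrite ltr_wpDl// powR_ge0.
pose k := minr 1 (d / (2 `^ b + 1)).
have k0 : 0 < k by rewrite lt_min ltr01 divr_gt0.
have k1 : k <= 1 by rewrite ge_min lexx.
have kd : (2 `^ b + 1) * k <= d.
  by rewrite mulrC -ler_pdivlMr// ge_min lexx orbT.
exists (2 * (k^-1 + 1) `^ b); first by rewrite mulr_ge0 ?powR_ge0.
move=> p W X p1 pb.
have p0 : 0 < p by lra.
have p10 : 0 <= p - 1 by lra.
have p1b : p - 1 <= b by lra.
set t := enorm W; set e := enorm (X - W); set s := enorm X.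
have t0 : 0 <= t := enorm_ge0 _.
have s0 : 0 <= s := enorm_ge0 _.
have e0 : 0 <= e := enorm_ge0 _.
have ste : s <= t + e by rewrite /s -[X in enorm X](subrKC W) enormD.
apply: (@le_trans _ _ ((s `^ (p - 1) + t `^ (p - 1)) * e)).
  rewrite /bregman -/s -/t [leRHS]mulrDl; apply: lerD; last first.
    by rewrite (le_trans (ler_norm _))// normrN flux_norm_le.
  have := flux_le_powR X W p1; rewrite -/s -/t => h.
  rewrite -opprB mulNr lerNl; apply: le_trans h.
  rewrite lerNl (le_trans (ler_norm _))// normrN.
  by rewrite (le_trans (flux_norm_le _ _ _))// -(opprB X W) enormN.
have [ek|ke] := leP e (k * t).
  apply: (@le_trans _ _ (d * t `^ p)); last first.
    by rewrite lerDl !mulr_ge0 ?powR_ge0.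
  have st : s <= 2 * t.
    by apply: le_trans ste _; rewrite mulr2n mulrDl mul1r lerD// (le_trans ek)// ler_piMl.
  apply: (@le_trans _ _ ((2 `^ b * t `^ (p - 1) + t `^ (p - 1)) * (k * t))).
    apply: ler_pM => //; rewrite ?addr_ge0 ?powR_ge0// lerD2r.
    apply: (@le_trans _ _ ((2 * t) `^ (p - 1))).
      by rewrite ge0_ler_powR// ?nnegrE// mulr_ge0.
    by rewrite powRM// ler_wpM2r ?powR_ge0// ler_powR// ler1n.
  rewrite -(mulr_powRB1 t0 p0).
  rewrite [leLHS](_ : _ = (2 `^ b + 1) * k * (t * t `^ (p - 1))); last by ring.
  by rewrite ler_wpM2r// mulr_ge0 ?powR_ge0.
apply: (@le_trans _ _ (2 * (k^-1 + 1) `^ b * e `^ p)); last first.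
  by rewrite lerDr mulr_ge0 ?powR_ge0// ltW.
have te : t <= k^-1 * e by rewrite mulrC ler_pdivlMr// mulrC ltW.
have ki : 0 <= k^-1 by rewrite invr_ge0 ltW.
have se : s <= (k^-1 + 1) * e by rewrite mulrDl mul1r (le_trans ste)// lerD2r.
have te' : t <= (k^-1 + 1) * e by rewrite (le_trans te)// ler_wpM2r// lerDl.
have H x : 0 <= x -> x <= (k^-1 + 1) * e ->
    x `^ (p - 1) <= (k^-1 + 1) `^ b * e `^ (p - 1).
  move=> x0 xe; apply: (@le_trans _ _ (((k^-1 + 1) * e) `^ (p - 1))).
    by rewrite ge0_ler_powR// ?nnegrE// mulr_ge0 ?addr_ge0.
  rewrite powRM ?addr_ge0// ler_wpM2r ?powR_ge0// ler_powR//.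
  by rewrite lerDr.
rewrite -(mulr_powRB1 e0 p0).
apply: (@le_trans _ _ (2 * ((k^-1 + 1) `^ b * e `^ (p - 1)) * e)).
  by rewrite ler_wpM2r// mulr2n mulrDl mul1r lerD// H.
by rewrite le_eqVlt; apply/orP; left; apply/eqP; ring.
Qed.

(** Uniform convexity: for unit [W] this is [young_gap_uniform], and the general
    case follows by homogeneity. *)
Lemma powR_enormB_le a b d : 1 < a -> 0 < d -> exists2 C : R, 0 <= C &
  forall p W X, a <= p -> p <= b ->
  enorm (X - W) `^ p <= d * enorm W `^ p + C * bregman p W X.
Proof.
move=> a1 d0; have [C C0 HC] := young_gap_uniform b a1 d0.
exists (maxr b C); first by rewrite le_max (ltW C0) orbT.
move=> p W X ap pb.
have p1 : 1 <= p by lra.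
have p0 : 0 < p by lra.
have D0 := bregman_ge0 W X p1.
have [/enorm0_eq0 W0|W0] := eqVneq (enorm W) 0.
  rewrite W0 subr0 enorm0 powR0 ?gt_eqF// mulr0 add0r.
  apply: (@le_trans _ _ (b * bregman p 0 X)); last first.
    by rewrite -W0 ler_wpM2r// le_max lexx.
  rewrite /bregman flux0 enorm0 powR0 ?gt_eqF// !subr0.
  by rewrite mulrCA ler_peMr ?powR_ge0// ler_pdivlMr// mul1r.
have t0' := enorm_ge0 W.
have t0 : 0 < enorm W by rewrite lt_def W0.
apply: (@le_trans _ _ (d * enorm W `^ p + C * bregman p W X)); last first.
  by rewrite lerD2l ler_wpM2r// le_max lexx orbT.
set t := enorm W in W0 t0' t0 *.
(* both sides divided by [t `^ p] are those of [young_gap_uniform] *)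
pose s := enorm X / t; pose m := s - dotV W X / t ^+ 2.
have s0 : 0 <= s by rewrite divr_ge0 ?enorm_ge0.
have /andP[m1 m2] : - (2 * s) + s <= dotV W X / t ^+ 2 <= s.
  have -> : - (2 * s) + s = - s by ring.
  rewrite -ler_norml normrM [X in _ * X]ger0_norm ?invr_ge0 ?exprn_ge0//.
  rewrite ler_pdivrMr ?exprn_gt0// (le_trans (dotV_norm_le _ _))//.
  by rewrite /s expr2 mulrA divfK// mulrC.
have m0 : 0 <= m by rewrite subr_ge0.
have ms : m <= 2 * s by rewrite /m; move: m1; clear; lra.
have ED : bregman p W X = t `^ p * (young_gap p s + m).
  rewrite /bregman /flux dotVBr -sqr_enorm -/t /young_gap /m.
  have -> : enorm X `^ p = t `^ p * s `^ p.
    by rewrite -powRM// mulrC divfK.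
  rewrite (powR_split2 p W0 t0'); field.
  by rewrite W0 gt_eqF.
have EX : enorm (X - W) = t * Num.sqrt ((s - 1) ^+ 2 + 2 * m).
  rewrite -[LHS]ger0_norm ?enorm_ge0// -sqrtr_sqr -[t in RHS]ger0_norm//.
  rewrite -[`|t|]sqrtr_sqr -sqrtrM ?sqr_ge0//; congr Num.sqrt.
  rewrite sqr_enormB -/t /m /s (dotVC X W); field.
  exact: W0.
rewrite EX powRM ?sqrtr_ge0// ED.
rewrite [leRHS](_ : _ = t `^ p * (d + C * (young_gap p s + m))); last by ring.
by rewrite ler_wpM2l ?powR_ge0// HC.
Qed.

End bregman.

(** * Integrals of fields with variable exponents *)

Lemma powRD_le {R : realType} (p s t : R) : 0 <= p -> 0 <= s -> 0 <= t ->
  (s + t) `^ p <= 2 `^ p * (s `^ p + t `^ p).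
Proof.
move=> p0; wlog ts : s t / t <= s.
  move=> H s0 t0; have [ts|/ltW st] := leP t s; first exact: H.
  by rewrite addrC [_ `^ p + _]addrC H.
move=> s0 t0; apply: (@le_trans _ _ ((2 * s) `^ p)).
  by rewrite ge0_ler_powR// ?nnegrE ?addr_ge0 ?mulr_ge0// mulr2n mulrDl mul1r lerD2l.
by rewrite powRM// ler_wpM2l ?powR_ge0// lerDl powR_ge0.
Qed.

Lemma measurable_fun_powR2 {R : realType} d (T : measurableType d) (D : set T)
    (f q : T -> R) : measurable D ->
  measurable_fun D f -> measurable_fun D q ->
  measurable_fun D (fun x => f x `^ q x).
Proof.
move=> mD mf mq; have m0 : measurable_fun D (fun=> 0 : R).
  exact: measurable_cst.
rewrite (_ : (fun _ => _) = fun x => if f x == 0 then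
    (if q x == 0 then 1 else 0) else expR (q x * ln (f x))); last first.
  by apply/funext => x; rewrite /powR; case: (q x == 0).
apply: measurable_fun_if => //; first exact: measurable_fun_eqr.
- apply: (@measurable_funS _ _ _ _ D) => //.
  by apply: measurable_fun_if => //; exact: measurable_fun_eqr.
- apply: (@measurable_funS _ _ _ _ D) => //.
  apply: measurableT_comp => //; apply: measurable_funM => //.
  by apply: measurableT_comp => //; exact: measurable_ln.
Qed.

Section variable_exponent_fields.
Context {R : realType} {d : measure_display} {T : measurableType d} {n : nat}.
Variables (mu : {measure set T -> \bar R}) (D : set T).
Hypothesis mD : measurable D.
Implicit Types (f g p q : T -> R) (X Y W V : T -> 'rV[R]_n).

Local Notation integ f := (mu.-integrable D (EFin \o f)).

Lemma integrableR_le f g : measurable_fun D f -> integ g ->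
  (forall x, D x -> `|f x| <= g x) -> integ f.
Proof.
move=> mf ig fg; apply: le_integrable ig => //; first exact/measurable_EFinP.
by move=> x Dx /=; rewrite lee_fin (le_trans (fg _ Dx))// ler_norm.
Qed.

Lemma integrableRD f g : integ f -> integ g -> integ (fun x => f x + g x).
Proof. exact: (integrableD mD). Qed.

Lemma integrableRB f g : integ f -> integ g -> integ (fun x => f x - g x).
Proof. exact: (integrableB mD). Qed.

Lemma integrableRZ (k : R) f : integ f -> integ (fun x => k * f x).
Proof. exact: (integrableZl mD). Qed.

Definition measurable_field X :=
  forall i, measurable_fun D (fun x => X x ord0 i).

Definition finite_modular q X :=
  measurable_field X /\ integ (fun x => enorm (X x) `^ q x).

Lemma measurable_fieldD X Y : measurable_field X -> measurable_field Y ->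
  measurable_field (fun x => X x + Y x).
Proof.
move=> mX mY i; rewrite (_ : (fun _ => _) = (fun x => X x ord0 i + Y x ord0 i)).
  exact: measurable_funD.
by apply/funext => x; rewrite mxE.
Qed.

Lemma measurable_fieldN X : measurable_field X ->
  measurable_field (fun x => - X x).
Proof.
move=> mX i; rewrite (_ : (fun _ => _) = (fun x => - X x ord0 i)).
  exact: measurable_funN.
by apply/funext => x; rewrite mxE.
Qed.

Lemma measurable_fieldB X Y : measurable_field X -> measurable_field Y ->
  measurable_field (fun x => X x - Y x).
Proof. by move=> mX mY; apply: measurable_fieldD => //; exact: measurable_fieldN. Qed.

Lemma measurable_fieldZ (l : R) X : measurable_field X ->
  measurable_field (fun x => l *: X x).
Proof.
move=> mX i; rewrite (_ : (fun _ => _) = (fun x => l * X x ord0 i)).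
  by apply: measurable_funM => //; exact: measurable_cst.
by apply/funext => x; rewrite mxE.
Qed.

Lemma measurable_dotV X Y : measurable_field X -> measurable_field Y ->
  measurable_fun D (fun x => dotV (X x) (Y x)).
Proof.
move=> mX mY; apply: measurable_sum => i.
exact: measurable_funM.
Qed.

Lemma measurable_enorm X : measurable_field X ->
  measurable_fun D (fun x => enorm (X x)).
Proof.
move=> mX; rewrite (_ : (fun _ => _) = (fun x => dotV (X x) (X x) `^ 2^-1)).
  apply: measurable_fun_powR2 => //; exact: measurable_dotV.
by apply/funext => x; rewrite powR12_sqrt// dotVv_ge0.
Qed.

Lemma measurable_powR_enorm q X : measurable_fun D q -> measurable_field X ->
  measurable_fun D (fun x => enorm (X x) `^ q x).
Proof. by move=> mq mX; apply: measurable_fun_powR2 => //; exact: measurable_enorm. Qed.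

Lemma measurable_flux q X Y : measurable_fun D q ->
  measurable_field X -> measurable_field Y ->
  measurable_fun D (fun x => flux (q x) (X x) (Y x)).
Proof.
move=> mq mX mY; apply: measurable_funM; last exact: measurable_dotV.
apply: measurable_fun_powR2 => //; first exact: measurable_enorm.
by apply: measurable_funB => //; exact: measurable_cst.
Qed.

Lemma integrable_flux q X Y : measurable_fun D q ->
  (forall x, D x -> 1 <= q x) -> finite_modular q X -> finite_modular q Y ->
  integ (fun x => flux (q x) (X x) (Y x)).
Proof.
move=> mq q1 [mX iX] [mY iY].
apply: integrableR_le (integrableRD iX iY) _; first exact: measurable_flux.
move=> x Dx; have := flux_norm_le_scaled (X x) (Y x) (q1 _ Dx) ltr01.
by rewrite mul1r divr1.
Qed.

Lemma finite_modularD q b X Y : measurable_fun D q ->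
  (forall x, D x -> 0 <= q x <= b) -> finite_modular q X -> finite_modular q Y ->
  finite_modular q (fun x => X x + Y x).
Proof.
move=> mq qb [mX iX] [mY iY]; split; first exact: measurable_fieldD.
apply: integrableR_le (integrableRZ (2 `^ b) (integrableRD iX iY)) _.
  by apply: measurable_powR_enorm => //; exact: measurable_fieldD.
move=> x Dx; have /andP[q0 qxb] := qb _ Dx.
rewrite ger0_norm ?powR_ge0//.
apply: (@le_trans _ _ ((enorm (X x) + enorm (Y x)) `^ q x)).
  by rewrite ge0_ler_powR// ?nnegrE ?addr_ge0 ?enorm_ge0// enormD.
apply: le_trans (powRD_le q0 (enorm_ge0 _) (enorm_ge0 _)) _.
by rewrite ler_wpM2r ?addr_ge0 ?powR_ge0// ler_powR// ler1n.
Qed.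

Lemma finite_modularN q X : finite_modular q X ->
  finite_modular q (fun x => - X x).
Proof.
move=> [mX iX]; split; first exact: measurable_fieldN.
by rewrite (_ : (fun _ => _) = (fun x => enorm (X x) `^ q x))//;
  apply/funext => x; rewrite enormN.
Qed.

Lemma finite_modularB q b X Y : measurable_fun D q ->
  (forall x, D x -> 0 <= q x <= b) -> finite_modular q X -> finite_modular q Y ->
  finite_modular q (fun x => X x - Y x).
Proof.
move=> mq qb fX fY.
exact: (finite_modularD mq qb fX (finite_modularN fY)).
Qed.

Hypothesis D_fin : (mu D < +oo)%E.

Lemma integrable_cstR (k : R) : integ (fun=> k).
Proof.
apply/integrableP; split; first exact/measurable_EFinP/measurable_cst.
by rewrite integral_cst//= lte_mul_pinfty// ?lee_fin.
Qed.

Lemma finite_modular_le p q X : measurable_fun D p ->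
  (forall x, D x -> 0 < p x <= q x) -> finite_modular q X -> finite_modular p X.
Proof.
move=> mp pq [mX iX]; split => //.
apply: integrableR_le (integrableRD (integrable_cstR 1) iX) _.
  exact: measurable_powR_enorm.
move=> x /pq /andP[p0 pqx].
by rewrite ger0_norm ?powR_ge0// powR_le_exponent// enorm_ge0.
Qed.

(** A substitute for Hoelder's inequality: for [M = 1] the last hypothesis says
    that the Luxemburg norm of [U] is at most [l], and the estimate is linear in
    this bound. *)
Lemma Rintegral_flux_le q X U (l M : R) : measurable_fun D q ->
  (forall x, D x -> 1 <= q x) -> finite_modular q X -> measurable_field U ->
  0 < l -> (\int[mu]_(x in D) ((enorm (U x) / l) `^ q x)%:E <= M%:E)%E ->
  integ (fun x => flux (q x) (X x) (U x)) /\
  `|\int[mu]_(x in D) flux (q x) (X x) (U x)| <=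
    l * (\int[mu]_(x in D) (enorm (X x) `^ q x) + M).
Proof.
move=> mq q1 [mX iX] mU l0 U1.
have iU : integ (fun x => (enorm (U x) / l) `^ q x).
  apply/integrableP; split.
    apply/measurable_EFinP/measurable_fun_powR2 => //.
    by apply: measurable_funM; [exact: measurable_enorm|exact: measurable_cst].
  rewrite (eq_integral (fun x => ((enorm (U x) / l) `^ q x)%:E)); last first.
    by move=> x _ /=; rewrite ger0_norm ?powR_ge0.
  by rewrite (le_lt_trans U1)// ltry.
have b x : D x -> `|flux (q x) (X x) (U x)| <=
    l * (enorm (X x) `^ q x + (enorm (U x) / l) `^ q x).
  by move=> Dx; rewrite flux_norm_le_scaled// q1.
have iXU := integrableRZ l (integrableRD iX iU).
have iF : integ (fun x => flux (q x) (X x) (U x)).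
  apply: integrableR_le iXU b; exact: measurable_flux.
split=> //; apply: le_trans (le_normr_Rintegral mD iF) _.
apply: (@le_trans _ _ (\int[mu]_(x in D)
    (l * (enorm (X x) `^ q x + (enorm (U x) / l) `^ q x)))).
  by apply: le_Rintegral => //; exact: integrable_norm.
rewrite RintegralZl//; last exact: integrableRD.
rewrite ler_wpM2l ?(ltW l0)// RintegralD// lerD2l.
rewrite -lee_fin fineK//; exact: integrable_fin_num.
Qed.

End variable_exponent_fields.

(** * Comparison of energies *)

(** [s^q/q + 1/p - 1/q - s^p/p], the price of replacing the exponent [p] by
    [q >= p] in the energy density. *)
Definition exponent_gap {R : realType} (p q s : R) : R :=
  (s `^ q - 1) / q - (s `^ p - 1) / p.

(** Minimality of [V] for the energy with exponent [q], seen from the Bregman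
    distance to [W] with exponent [p]: since [exponent_gap p q |V| >= 0], the
    [p]-energy of [V] is at most its [q]-energy up to a constant, and the latter
    is controlled by convexity through the flux of [V]. The last term integrates
    to [0] when [V] and [W] solve equations with the same right-hand side. *)
Lemma bregman_competitor {R : realType} {n : nat} (p q : R) (W V Z : 'rV[R]_n) :
  1 <= p -> p <= q ->
  bregman p W V <= bregman p W Z + exponent_gap p q (enorm Z) +
    (flux p W (Z - V) - flux q V (Z - V)).
Proof.
move=> p1 pq; have q1 : 1 <= q by exact: le_trans pq.
have -> : flux p W (Z - V) = flux p W (Z - W) - flux p W (V - W).
  by rewrite -fluxBr opprB addrA subrK.
have aux (zq zp vq vp wp fz fv g : R) : g <= (zq - vq) / q ->
    (vp - 1) / p <= (vq - 1) / q -> (vp - wp) / p - fv <=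
    (zp - wp) / p - fz + ((zq - 1) / q - (zp - 1) / p) + (fz - fv - g).
  by move: p^-1 q^-1 => a b; lra.
apply: aux; [exact: flux_le_powR|exact: powR_exponent_mono (enorm_ge0 V)].
Qed.

Section flux_closure.
Context {R : realType} {d : measure_display} {T : measurableType d} {n : nat}.
Variables (mu : {measure set T -> \bar R}) (D : set T).
Hypotheses (mD : measurable D) (D_fin : (mu D < +oo)%E).
Implicit Types (p q : T -> R) (W V Z : T -> 'rV[R]_n).

Local Notation integ f := (mu.-integrable D (EFin \o f)).

Lemma Rintegral_small_eq0 (x M : R) : 0 <= M ->
  (forall e, 0 < e -> `|x| <= e * M) -> x = 0.
Proof.
move=> M0 H; apply/eqP; rewrite -normr_le0; apply/ler_addgt0Pr => e e0; rewrite add0r.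
have M1 : 0 < M + 1 by rewrite ltr_wpDl.
have := H (e / (M + 1)) (divr_gt0 e0 M1); move=> /le_trans; apply.
by rewrite mulrAC ler_pdivrMr// ler_wpM2l ?lerDl// ltW.
Qed.

(** Both sides are continuous in [Z] for the exponent [q] by [Rintegral_flux_le],
    since the modular of the smaller exponent [p] is controlled by that of [q]
    on a domain of finite measure. *)
Lemma flux_eq_closure (H : set (T -> 'rV[R]_n)) p q b W V Z :
  measurable_fun D p -> measurable_fun D q ->
  (forall x, D x -> 1 <= p x <= q x) -> (forall x, D x -> q x <= b) ->
  finite_modular mu D p W -> finite_modular mu D q V ->
  measurable_field D Z ->
  (forall K, H K -> finite_modular mu D q K) ->
  (forall K, H K -> \int[mu]_(x in D) flux (p x) (W x) (K x) =
                    \int[mu]_(x in D) flux (q x) (V x) (K x)) ->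
  (forall e : R, 0 < e -> exists K l, [/\ H K, 0 < l, l <= e &
     (\int[mu]_(x in D) ((enorm (Z x - K x) / l) `^ q x)%:E <= 1)%E]) ->
  \int[mu]_(x in D) flux (p x) (W x) (Z x) =
  \int[mu]_(x in D) flux (q x) (V x) (Z x).
Proof.
move=> mp mq pq qb fW fV mZ fH eqH approx.
have p1 x : D x -> 1 <= p x by move=> /pq /andP[].
have q1 x : D x -> 1 <= q x by move=> /pq /andP[]; exact: le_trans.
have p0q x : D x -> 0 < p x <= q x.
  by move=> /pq /andP[p1x ->]; rewrite (lt_le_trans ltr01 p1x).
pose A := \int[mu]_(x in D) (enorm (W x) `^ p x).
pose B := \int[mu]_(x in D) (enorm (V x) `^ q x).
pose c := fine (mu D).
have A0 : 0 <= A by apply: Rintegral_ge0 => x _; exact: powR_ge0.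
have B0 : 0 <= B by apply: Rintegral_ge0 => x _; exact: powR_ge0.
have c0 : 0 <= c by rewrite fine_ge0// measure_ge0.
have M0 : 0 <= A + (c + 1) + (B + 1) by rewrite !addr_ge0.
apply/eqP; rewrite -subr_eq0; apply/eqP.
apply: (@Rintegral_small_eq0 _ (A + (c + 1) + (B + 1))).
  exact: M0.
move=> e e0; have [K [l [HK l0 le ZK]]] := approx _ e0.
have fK := fH _ HK; have eK := eqH _ HK.
have mZK : measurable_field D (fun x => Z x - K x).
  by apply: measurable_fieldB => //; case: fK.
have [iqF qF] := Rintegral_flux_le mD mq q1 fV mZK l0 ZK.
have ZKp : (\int[mu]_(x in D) ((enorm (Z x - K x) / l) `^ p x)%:E <=
    (c + 1)%:E)%E.
  have mU (r : T -> R) : measurable_fun D r ->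
      measurable_fun D (fun x => (enorm (Z x - K x) / l) `^ r x).
    move=> mr; apply: measurable_fun_powR2 => //.
    by apply: measurable_funM; [exact: measurable_enorm|exact: measurable_cst].
  apply: (@le_trans _ _ (\int[mu]_(x in D)
      (1%:E + ((enorm (Z x - K x) / l) `^ q x)%:E))%E).
    apply: ge0_le_integral => //.
    - by move=> x _; rewrite lee_fin powR_ge0.
    - exact/measurable_EFinP/mU.
    - apply: emeasurable_funD; first exact: measurable_cst.
      exact/measurable_EFinP/mU.
    - move=> x Dx; rewrite -EFinD lee_fin; have /andP[p0 pqx] := p0q _ Dx.
      by rewrite powR_le_exponent// divr_ge0 ?enorm_ge0// ltW.
  rewrite ge0_integralD//.
  - rewrite integral_cst// mul1e EFinD leeD// /c fineK//.
    by rewrite ge0_fin_numE ?measure_ge0.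
  - by move=> x _; rewrite lee_fin powR_ge0.
  - exact/measurable_EFinP/mU.
have [ipF pF] := Rintegral_flux_le mD mp p1 fW mZK l0 ZKp.
have fKp := finite_modular_le mD D_fin mp p0q fK.
have ipK := integrable_flux mD mp p1 fW fKp.
have iqK := integrable_flux mD mq q1 fV fK.
have -> : \int[mu]_(x in D) flux (p x) (W x) (Z x) =
    \int[mu]_(x in D) (flux (p x) (W x) (K x) + flux (p x) (W x) (Z x - K x)).
  by apply: eq_Rintegral => x _; rewrite fluxBr addrC subrK.
have -> : \int[mu]_(x in D) flux (q x) (V x) (Z x) =
    \int[mu]_(x in D) (flux (q x) (V x) (K x) + flux (q x) (V x) (Z x - K x)).
  by apply: eq_Rintegral => x _; rewrite fluxBr addrC subrK.
rewrite !RintegralD// eK opprD addrACA subrr add0r.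
rewrite (le_trans (ler_normB _ _))// -/A -/B.
apply: (@le_trans _ _ (l * (A + (c + 1) + (B + 1)))).
  by rewrite mulrDr lerD.
by rewrite ler_wpM2r.
Qed.

End flux_closure.

Section exponent_limit.
Context {R : realType} {d : measure_display} {T : measurableType d} {n : nat}.
Variables (mu : {measure set T -> \bar R}) (D : set T).
Hypotheses (mD : measurable D) (D_fin : (mu D < +oo)%E).
Implicit Types (p q : T -> R) (W V Z : T -> 'rV[R]_n).

Local Notation integ f := (mu.-integrable D (EFin \o f)).

Lemma cvg_powR_exponent (s p : R) (u : nat -> R) : 0 <= s -> 0 < p ->
  (forall i, 0 < u i) -> u @ \oo --> p -> (fun i => s `^ u i) @ \oo --> s `^ p.
Proof.
move=> s0 p0 u0 up; have [->|sN0] := eqVneq s 0.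
  rewrite powR0 ?gt_eqF// (_ : (fun _ => _) = fun=> 0); first exact: cvg_cst.
  by apply/funext => i; rewrite powR0// gt_eqF.
rewrite /powR (negbTE sN0).
apply: (@continuous_cvg _ _ _ _ _ _ expR); first exact: continuous_expR.
exact: cvgMl up.
Qed.

Lemma exponent_gap_cvg0 (s p : R) (u : nat -> R) : 0 <= s -> 0 < p ->
  (forall i, 0 < u i) -> u @ \oo --> p ->
  (fun i => exponent_gap p (u i) s) @ \oo --> 0.
Proof.
move=> s0 p0 u0 up; rewrite -[X in _ --> X](subrr ((s `^ p - 1) / p)).
apply: cvgB; last exact: cvg_cst.
apply: cvgM.
  by apply: cvgB; [exact: cvg_powR_exponent|exact: cvg_cst].
by apply: cvgV => //; rewrite gt_eqF.
Qed.

Lemma exponent_gap_norm_le (s p q r : R) : 1 <= p -> 1 <= q -> p <= r -> q <= r ->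
  0 <= s -> `|exponent_gap p q s| <= 4 + 2 * s `^ r.
Proof.
move=> p1 q1 pr qr s0.
have H t : 1 <= t -> t <= r -> `|(s `^ t - 1) / t| <= 2 + s `^ r.
  move=> t1 tr; have t0 : 0 < t by rewrite (lt_le_trans ltr01).
  rewrite normrM [`|t^-1|]ger0_norm ?invr_ge0 ?(ltW t0)//.
  rewrite ler_pdivrMr// (@le_trans _ _ (2 + s `^ r))//; last first.
    by rewrite ler_peMr// addr_ge0 ?powR_ge0.
  rewrite (le_trans (ler_normB _ _))// normr1 ger0_norm ?powR_ge0//.
  by have := powR_le_exponent s0 t0 tr; lra.
rewrite (le_trans (ler_normB _ _))//.
by have := H _ p1 pr; have := H _ q1 qr; lra.
Qed.

Lemma measurable_exponent_gap p q (f : T -> R) :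
  measurable_fun D p -> measurable_fun D q -> measurable_fun D f ->
  (forall x, D x -> 0 <= p x) -> (forall x, D x -> 0 <= q x) ->
  measurable_fun D (fun x => exponent_gap (p x) (q x) (f x)).
Proof.
move=> mp mq mf p0 q0.
have H (r : T -> R) : measurable_fun D r -> (forall x, D x -> 0 <= r x) ->
    measurable_fun D (fun x => (f x `^ r x - 1) / r x).
  move=> mr r0; apply: measurable_funM.
    by apply: measurable_funB; [exact: measurable_fun_powR2|exact: measurable_cst].
  apply: (@eq_measurable_fun _ _ _ _ _ (fun x => r x `^ (-1))).
    by move=> x /set_mem Dx; rewrite powR_inv1// r0.
  by apply: measurable_fun_powR2 => //; exact: measurable_cst.
by apply: measurable_funB; exact: H.
Qed.

Lemma Rintegral_exponent_gap_cvg0 p (q_ : nat -> T -> R) Z :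
  measurable_fun D p -> (forall i, measurable_fun D (q_ i)) ->
  (forall x, D x -> 1 <= p x) ->
  (forall i x, D x -> p x <= q_ i x <= q_ 0%N x) ->
  (forall x, D x -> q_ ^~ x @ \oo --> p x) ->
  finite_modular mu D (q_ 0%N) Z ->
  (forall i, integ (fun x => exponent_gap (p x) (q_ i x) (enorm (Z x)))) /\
  (fun i => \int[mu]_(x in D) exponent_gap (p x) (q_ i x) (enorm (Z x)))
    @ \oo --> 0.
Proof.
move=> mp mq p1 pq qp [mZ iZ].
have q1 i x : D x -> 1 <= q_ i x.
  by move=> Dx; have /andP[+ _] := pq i x Dx; exact/le_trans/p1.
have mg i : measurable_fun D (fun x => exponent_gap (p x) (q_ i x) (enorm (Z x))).
  apply: measurable_exponent_gap => //; first exact: measurable_enorm.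
    by move=> x /p1; exact: le_trans.
  by move=> x /(q1 i); exact: le_trans.
have ib : integ (fun x => 4 + 2 * enorm (Z x) `^ q_ 0%N x).
  by apply: integrableRD => //; [exact: integrable_cstR|exact: integrableRZ].
have gb i x : D x -> `|exponent_gap (p x) (q_ i x) (enorm (Z x))| <=
    4 + 2 * enorm (Z x) `^ q_ 0%N x.
  move=> Dx; have /andP[pqi qi0] := pq i x Dx.
  by rewrite exponent_gap_norm_le ?p1 ?q1 ?enorm_ge0// (le_trans pqi).
have ig i : integ (fun x => exponent_gap (p x) (q_ i x) (enorm (Z x))).
  exact: integrableR_le (mg i) ib (gb i).
split => //.
have [|||||_ _ +] := @dominated_convergence _ _ _ mu D mD
  (fun i x => (exponent_gap (p x) (q_ i x) (enorm (Z x)))%:E) (cst 0%E)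
  (fun x => (4 + 2 * enorm (Z x) `^ q_ 0%N x)%:E).
- by move=> i; exact/measurable_EFinP.
- exact: measurable_cst.
- apply: aeW => x Dx; apply: cvg_EFin; first exact: nearW.
  apply: exponent_gap_cvg0 (qp _ Dx); rewrite ?enorm_ge0//.
    by rewrite (lt_le_trans ltr01)// p1.
  by move=> i; rewrite (lt_le_trans ltr01)// q1.
- exact: ib.
- by apply: aeW => x i Dx /=; rewrite lee_fin gb.
rewrite integral0 => /fine_cvgP[_]; exact.
Qed.

(** The competitor [Phi + K] is independent of [i] and lies in all the
    spaces at once; the exponent gap disappears along it, and its own Bregman
    distance to [W] is small by density. *)
Lemma energy_convergence (H : set (T -> 'rV[R]_n)) p (q_ : nat -> T -> R)
    (a b : R) W Phi (V_ : nat -> T -> 'rV[R]_n) :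
  1 < a -> measurable_fun D p -> (forall i, measurable_fun D (q_ i)) ->
  (forall x, D x -> a <= p x) -> (forall x, D x -> q_ 0%N x <= b) ->
  (forall i x, D x -> p x <= q_ i x <= q_ 0%N x) ->
  (forall x, D x -> q_ ^~ x @ \oo --> p x) ->
  finite_modular mu D p W -> finite_modular mu D (q_ 0%N) Phi ->
  (forall i, finite_modular mu D (q_ i) (V_ i)) ->
  (forall K, H K -> finite_modular mu D (q_ 0%N) K) ->
  (forall e : R, 0 < e -> exists2 K, H K &
     \int[mu]_(x in D) enorm (Phi x + K x - W x) `^ p x <= e) ->
  (forall i K, H K ->
     \int[mu]_(x in D) flux (p x) (W x) (Phi x + K x - V_ i x) =
     \int[mu]_(x in D) flux (q_ i x) (V_ i x) (Phi x + K x - V_ i x)) ->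
  (forall i, finite_modular mu D p (fun x => V_ i x - W x)) /\
  (fun i => \int[mu]_(x in D) enorm (V_ i x - W x) `^ p x) @ \oo --> 0.
Proof.
move=> a1 mp mq ap q0b pq qp fW fPhi fV fH dens eqf.
have p1 x : D x -> 1 <= p x by move=> /ap; apply: le_trans; exact: ltW.
have p0 x : D x -> 0 < p x by move=> /p1; exact: lt_le_trans.
have pb x : D x -> p x <= b.
  by move=> Dx; have /andP[+ _] := pq 0%N x Dx; move=> /le_trans; apply; exact: q0b.
have p0b x : D x -> 0 <= p x <= b by move=> Dx; rewrite ltW ?p0// pb.
have q0 i x : D x -> 0 < q_ i x.
  by move=> Dx; have /andP[+ _] := pq i x Dx; exact/lt_le_trans/p0.
have q1 i x : D x -> 1 <= q_ i x.
  by move=> Dx; have /andP[+ _] := pq i x Dx; exact/le_trans/p1.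
have q0b' i x : D x -> 0 <= q_ i x <= b.
  move=> Dx; rewrite (ltW (q0 _ _ Dx))/=; have /andP[_] := pq i x Dx.
  by move=> /le_trans; apply; exact: q0b.
have pqi i x : D x -> 0 < p x <= q_ i x.
  by move=> Dx; rewrite p0//; have /andP[-> _] := pq i x Dx.
have qi0 i x : D x -> 0 < q_ i x <= q_ 0%N x.
  by move=> Dx; rewrite q0//; have /andP[_ ->] := pq i x Dx.
have fVp i : finite_modular mu D p (V_ i).
  exact: (finite_modular_le mD D_fin mp (pqi i) (fV i)).
have fVW i : finite_modular mu D p (fun x => V_ i x - W x).
  exact: (finite_modularB mD mp p0b (fVp i) fW).
split => //; apply/cvgr0Pnorm_le => e e0.
have four (y : R) : y <= e / 4 -> e / 4 + (y + y + y) <= e by lra.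
pose M := \int[mu]_(x in D) enorm (W x) `^ p x.
have M0 : 0 <= M by apply: Rintegral_ge0 => x _; exact: powR_ge0.
have M1 : 0 < M + 1 by rewrite ltr_wpDl.
have [C1 C10 HC1] := @powR_enormB_le R n a b (e / 4 / (M + 1)) a1
  (divr_gt0 (divr_gt0 e0 (ltr0n _ 4)) M1).
have C11 : 0 < C1 + 1 by rewrite ltr_wpDl.
pose e1 := e / 4 / (C1 + 1).
have e10 : 0 < e1 by rewrite !divr_gt0.
have [C2 C20 HC2] := @bregman_le R n b (e1 / (M + 1)) (divr_gt0 e10 M1).
have C21 : 0 < C2 + 1 by rewrite ltr_wpDl.
have [K HK WK] := dens (e1 / (C2 + 1)) (divr_gt0 e10 C21).
pose Z x := Phi x + K x.
have fZ : finite_modular mu D (q_ 0%N) Z.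
  by apply: (finite_modularD mD (mq 0%N) (q0b' 0%N) fPhi); exact: fH.
have fZp : finite_modular mu D p Z.
  exact: (finite_modular_le mD D_fin mp (pqi 0%N) fZ).
have fZW := finite_modularB mD mp p0b fZp fW.
have [ig gap0] := Rintegral_exponent_gap_cvg0 mp mq p1 pq qp fZ.
have gapN : \forall i \near \oo,
    `|\int[mu]_(x in D) exponent_gap (p x) (q_ i x) (enorm (Z x))| <= e1.
  by move/cvgr0Pnorm_le : gap0; exact.
near=> i.
have gap_e : \int[mu]_(x in D) exponent_gap (p x) (q_ i x) (enorm (Z x)) <= e1.
  by apply: le_trans (ler_norm _) _; near: i; exact: gapN.
have fZi : finite_modular mu D (q_ i) Z.
  exact: (finite_modular_le mD D_fin (mq i) (qi0 i) fZ).
have ifp := integrable_flux mD mp p1 fW (finite_modularB mD mp p0b fZp (fVp i)).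
have ifq := integrable_flux mD (mq i) (q1 i) (fV i)
  (finite_modularB mD (mq i) (q0b' i) fZi (fV i)).
pose gap x := exponent_gap (p x) (q_ i x) (enorm (Z x)).
pose rhs x := e / 4 / (M + 1) * enorm (W x) `^ p x +
  C1 * (e1 / (M + 1) * enorm (W x) `^ p x + C2 * enorm (Z x - W x) `^ p x +
    gap x + (flux (p x) (W x) (Z x - V_ i x) -
             flux (q_ i x) (V_ i x) (Z x - V_ i x))).
have iW := fW.2; have iZW := fZW.2; have igap : integ gap := ig i.
have i1 := integrableRD mD (integrableRZ mD (e1 / (M + 1)) iW) (integrableRZ mD C2 iZW).
have i2 := integrableRD mD i1 igap.
have i3 := integrableRB mD ifp ifq.
have i4 := integrableRD mD i2 i3.
have i0 := integrableRZ mD (e / 4 / (M + 1)) iW.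
have irhs : integ rhs by exact: (integrableRD mD i0 (integrableRZ mD C1 i4)).
rewrite ger0_norm; last by apply: Rintegral_ge0 => x _; exact: powR_ge0.
apply: (@le_trans _ _ (\int[mu]_(x in D) rhs x)).
  apply: (le_Rintegral mD (fVW i).2 irhs) => x Dx.
  apply: le_trans (HC1 _ _ _ (ap _ Dx) (pb _ Dx)) _.
  rewrite lerD2l ler_wpM2l//; have /andP[_ pqx] := pqi i x Dx.
  apply: le_trans (bregman_competitor _ _ (Z x) (p1 _ Dx) pqx) _.
  by rewrite !lerD2r HC2 ?p1 ?pb.
have -> : \int[mu]_(x in D) rhs x = e / 4 / (M + 1) * M + C1 * (e1 / (M + 1) * M
    + C2 * (\int[mu]_(x in D) enorm (Z x - W x) `^ p x)
    + \int[mu]_(x in D) gap x).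
  rewrite (RintegralD mD i0 (integrableRZ mD C1 i4)) !RintegralZl//.
  rewrite (RintegralD mD i2 i3) (RintegralB mD ifp ifq) eqf// subrr addr0.
  rewrite (RintegralD mD i1 igap).
  by rewrite (RintegralD mD (integrableRZ mD _ iW) (integrableRZ mD C2 iZW)) !RintegralZl.
have frac (x y : R) : 0 <= x -> 0 <= y -> x / (y + 1) * y <= x.
  move=> x0 y0; rewrite mulrAC ler_pdivrMr ?ltr_wpDl//.
  by rewrite ler_wpM2l// lerDl.
have h1 : e / 4 / (M + 1) * M <= e / 4 by rewrite frac// divr_ge0// ltW.
have h2 : e1 / (M + 1) * M <= e1 by rewrite frac// ltW.
have h3 : C2 * (\int[mu]_(x in D) enorm (Z x - W x) `^ p x) <= e1.
  apply: le_trans (ler_wpM2l C20 WK) _.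
  by rewrite mulrC frac// ltW.
have h4 : C1 * e1 <= e / 4.
  by rewrite mulrC frac// divr_ge0// ltW.
have h5 : C1 * (e1 / (M + 1) * M
    + C2 * (\int[mu]_(x in D) enorm (Z x - W x) `^ p x)
    + \int[mu]_(x in D) gap x) <= C1 * (e1 + e1 + e1).
  by rewrite ler_wpM2l//; exact: (lerD (lerD h2 h3) gap_e).
apply: le_trans (lerD h1 h5) _.
by rewrite !(mulrDr C1) four.
Unshelve. all: by end_near.
Qed.

End exponent_limit.

(** * Boxes and Borel sets in R^n *)

Section boxes.
Context {R : realType} {n : nat}.
Implicit Types (A : set 'rV[R]_n) (a b x : 'rV[R]_n).

Definition open_box a b : set 'rV[R]_n :=
  [set x | forall i, a ord0 i < x ord0 i < b ord0 i].

Definition closed_box a b : set 'rV[R]_n :=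
  [set x | forall i, a ord0 i <= x ord0 i <= b ord0 i].

Lemma open_box_sub a b : open_box a b `<=` closed_box a b.
Proof. by move=> x abx i; have /andP[/ltW -> /ltW ->] := abx i. Qed.

Definition ratr_rV (a : 'rV[rat]_n) : 'rV[R]_n := map_mx ratr a.

Lemma open_rational_box A x : open A -> A x -> exists a b : 'rV[rat]_n,
  open_box (ratr_rV a) (ratr_rV b) x /\
  closed_box (ratr_rV a) (ratr_rV b) `<=` A.
Proof.
move=> oA Ax; have /nbhs_ballP[e /= e0 eA] := open_nbhs_nbhs (conj oA Ax).
have ha i : exists q : rat, (ratr q : R) \in `](x ord0 i - e), (x ord0 i)[.
  by apply: rat_in_itvoo; rewrite ltrBlDr ltrDl.
have hb i : exists q : rat, (ratr q : R) \in `](x ord0 i), (x ord0 i + e)[.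
  by apply: rat_in_itvoo; rewrite ltrDl.
have [a Ha] := choice ha; have [b Hb] := choice hb.
exists (\row_i a i), (\row_i b i); split.
  move=> i; rewrite !mxE; move: (Ha i) (Hb i).
  by rewrite !in_itv/= => /andP[_ ->] /andP[->].
move=> y aby; apply: eA; split => // i j; rewrite ord1.
have := aby j; rewrite !mxE /ball/= ltr_distlC.
move: (Ha j) (Hb j); rewrite !in_itv/= => /andP[h1 _] /andP[_ h2] /andP[h3 h4].
by rewrite (lt_le_trans h1 h3) (le_lt_trans h4 h2).
Qed.

Lemma measurable_box (I : 'I_n -> set R) : (forall i, measurable (I i)) ->
  measurable [set x : 'rV[R]_n | forall i, I i (x ord0 i)].
Proof.
move=> mI; rewrite (_ : [set x | _] = \bigcap_(i in [set: 'I_n])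
    ((fun v : 'rV[R]_n => v ord0 i) @^-1` I i)).
  apply: fin_bigcap_measurable => // i _; rewrite -[X in measurable X]setTI.
  exact: measurable_coor.
by apply/seteqP; split=> [v Av i _|v Av i]; exact: Av.
Qed.

Lemma open_boxE a b :
  open_box a b = [set x | forall i, `]a ord0 i, b ord0 i[%classic (x ord0 i)].
Proof. by apply/seteqP; split => x abx i; have := abx i; rewrite /= in_itv. Qed.

Lemma closed_boxE a b :
  closed_box a b = [set x | forall i, `[a ord0 i, b ord0 i]%classic (x ord0 i)].
Proof. by apply/seteqP; split => x abx i; have := abx i; rewrite /= in_itv. Qed.

Lemma measurable_open_box a b : measurable (open_box a b).
Proof.
rewrite open_boxE.
by apply: (@measurable_box (fun i => `]a ord0 i, b ord0 i[%classic)).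
Qed.

Lemma measurable_closed_box a b : measurable (closed_box a b).
Proof.
rewrite closed_boxE.
by apply: (@measurable_box (fun i => `[a ord0 i, b ord0 i]%classic)).
Qed.

Lemma compact_closed_box a b : compact (closed_box a b).
Proof.
rewrite closed_boxE.
apply: (@rV_compact _ _ (fun i => `[a ord0 i, b ord0 i]%classic)) => i.
exact: segment_compact.
Qed.

(** Open sets are countable unions of rational boxes. *)
Lemma open_measurable_rV A : open A -> measurable A.
Proof.
move=> oA.
pose F (ab : 'rV[rat]_n * 'rV[rat]_n) : set 'rV[R]_n :=
  if `[< closed_box (ratr_rV ab.1) (ratr_rV ab.2) `<=` A >]
  then open_box (ratr_rV ab.1) (ratr_rV ab.2) else set0.
rewrite (_ : A = \bigcup_ab F ab).
  apply: countable_bigcupT_measurable => // ab; rewrite /F.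
  by case: ifPn => // _; exact: measurable_open_box.
apply/seteqP; split => x.
  move=> Ax; have [a [b [xab abA]]] := open_rational_box oA Ax.
  by exists (a, b) => //; rewrite /F; case: ifPn => // /asboolP.
move=> [ab _]; rewrite /F; case: ifPn => // /asboolP abA /open_box_sub; exact: abA.
Qed.

Lemma closed_measurable_rV A : closed A -> measurable A.
Proof. by move=> /closed_openC/open_measurable_rV/measurableC; rewrite setCK. Qed.

Lemma compact_measurable_rV A : compact A -> measurable A.
Proof.
move=> cA; apply: closed_measurable_rV; apply: compact_closed cA.
exact: norm_hausdorff.
Qed.

Lemma continuous_measurable_rV A (f : 'rV[R]_n -> R) : open A ->
  (forall x, A x -> {for x, continuous f}) -> measurable_fun A f.
Proof.
move=> oA cf mA; apply: (measurability _ (RGenOInfty.measurableE R)) => //.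
move=> /= _ [_ [a ->] <-]; apply: open_measurable_rV.
rewrite openE => x [Ax fx]; rewrite /interior.
apply: filterI; first exact: open_nbhs_nbhs.
by apply: cf => //; apply: open_nbhs_nbhs; split => //; exact: interval_open.
Qed.

Lemma continuous_measurable_rVT (f : 'rV[R]_n -> R) :
  continuous f -> measurable_fun setT f.
Proof. by move=> cf; apply: (continuous_measurable_rV openT) => x _; exact: cf. Qed.

Lemma closed_box_finite a b : (lebesgue_rV n (closed_box a b) < +oo)%E.
Proof.
rewrite closed_boxE (@lebesgue_rV_box _ _ (fun i => `[a ord0 i, b ord0 i]%classic))//.
have H : (forall i : 'I_n, lebesgue_measure `[a ord0 i, b ord0 i]%classic \is a fin_num).
  by move=> i; rewrite lebesgue_measure_itv/=; case: ifPn.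
rewrite ltey_eq; apply/orP; left.
by elim/big_ind : _ => // x y fx fy; rewrite fin_numM.
Qed.

Lemma bounded_sub_box A : bounded_set A -> exists2 M : R, 0 < M &
  A `<=` closed_box (const_mx (- M)) (const_mx M).
Proof.
move=> [M [_ HM]]; exists (`|M| + 1); first by rewrite ltr_wpDl.
move=> x Ax i; rewrite !mxE -ler_norml.
have := HM (`|M| + 1); rewrite (le_lt_trans (ler_norm M)) ?ltrDl// => /(_ isT x Ax).
apply: le_trans; rewrite -[X in _ <= X]/(mx_norm x) mx_normrE.
exact: (le_bigmax _ (fun ij : 'I_1 * 'I_n => `|x ij.1 ij.2|) (ord0, i)).
Qed.

Lemma bounded_finite A : measurable A -> bounded_set A ->
  (lebesgue_rV n A < +oo)%E.
Proof.
move=> mA /bounded_sub_box[M _ AM]; apply: le_lt_trans (closed_box_finite _ _).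
by apply: le_measure AM; rewrite inE//; exact: measurable_closed_box.
Qed.

End boxes.

(** * The integral of a derivative with compact support *)

Section integral_of_derivative.
Context {R : realType}.

Lemma integral_derive_eq0 (F G : R -> R) (M : R) : 0 < M ->
  (forall t : R, is_derive t 1 F (G t)) -> continuous G ->
  (forall t, M < `|t| -> F t = 0 /\ G t = 0) ->
  (\int[@lebesgue_measure R]_t (G t)%:E = 0)%E.
Proof.
move=> M0 dF cG sup.
have cF : continuous F.
  move=> t; apply: differentiable_continuous; apply/derivable1_diffP.
  by have := dF t => -[].
pose N := M + 1.
have MN : - N < N by rewrite /N; lra.
have supN (t : R) : ~ `[-N, N]%classic t -> G t = 0.
  move=> H; suff /sup[] : M < `|t| by [].
  rewrite ltNge; apply/negP; rewrite ler_norml => /andP[h1 h2].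
  by apply: H; rewrite /= in_itv/= /N; apply/andP; split; lra.
have -> : (\int[@lebesgue_measure R]_t (G t)%:E =
    \int[@lebesgue_measure R]_(t in `[(- N)%R, N]) (G t)%:E)%E.
  rewrite [RHS]integral_mkcond; apply: eq_integral => t _.
  rewrite patchE; case: ifPn => // /negP tN.
  by rewrite (supN t _)// => h; apply: tN; rewrite inE.
rewrite (continuous_FTC2 MN (F := F)).
- by rewrite (sup N _).1 ?(sup (- N) _).1 ?subee// ?normrN /N gtr0_norm; lra.
- exact: continuous_subspaceT.
- split.
  + by move=> t _; have := dF t => -[].
  + by apply: cvg_at_right_filter; exact: cF.
  + by apply: cvg_at_left_filter; exact: cF.
- by move=> t _; rewrite derive1E; have := dF t => -[].
Qed.

Let cube n (M : R) : set 'rV[R]_n := closed_box (const_mx (- M)) (const_mx M).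

Lemma integrable_bounded_support n (G : 'rV[R]_n -> R) (a b : 'rV[R]_n) (B : R) :
  measurable_fun setT G -> (forall x, `|G x| <= B) ->
  (forall x, ~ closed_box a b x -> G x = 0) ->
  (lebesgue_rV n).-integrable setT (EFin \o G).
Proof.
move=> mG GB G0.
have mb : measurable (closed_box a b) by exact: measurable_closed_box.
have -> : EFin \o G = (EFin \o G) \_ (closed_box a b).
  apply/funext => x; rewrite patchE; case: ifPn => // /negP xb.
  by rewrite /= G0// => h; apply: xb; rewrite inE.
apply/(integrable_mkcond _ mb); apply: measurable_bounded_integrable => //.
- exact: closed_box_finite.
- exact: measurable_funTS.
- exists B; split; first by rewrite num_real.
  by move=> C BC x _ /=; rewrite (le_trans (GB x))// ltW.
Qed.

Lemma integrable_cons_rV n (f : 'rV[R]_n.+1 -> \bar R) :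
  (lebesgue_rV n.+1).-integrable setT f ->
  (@lebesgue_measure R \x lebesgue_rV n)%E.-integrable setT (f \o @cons_rV R n).
Proof.
move=> /integrableP[mf fi]; apply/integrableP; split.
  by apply: measurableT_comp => //; exact: measurable_cons_rV.
rewrite (le_lt_trans _ fi)//.
have := @ge0_integral_pushforward _ _ (measurableTypeR R * 'rV[R]_n)%type
  'rV[R]_n.+1 R (@cons_rV R n) (@measurable_cons_rV R n) _ setT (abse \o f).
move=> /(_ (@lebesgue_measure R \x lebesgue_rV n)%E).
rewrite preimage_setT => <- //; first exact: measurableT_comp.
by move=> y _; exact: abse_ge0.
Qed.

Lemma integral_rV_succ n (f : 'rV[R]_n.+1 -> \bar R) :
  (lebesgue_rV n.+1).-integrable setT f ->
  (\int[lebesgue_rV n.+1]_x f x =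
   \int[@lebesgue_measure R \x lebesgue_rV n]_z f (cons_rV z))%E.
Proof.
move=> fi; have fc := integrable_cons_rV fi.
have mf : measurable_fun setT f by case/integrableP : fi.
have := @integral_pushforward _ _ (measurableTypeR R * 'rV[R]_n)%type
  'rV[R]_n.+1 R (@cons_rV R n) (@measurable_cons_rV R n) _ setT f mf.
rewrite preimage_setT; exact.
Qed.

Lemma cons_rV0 n (x : R) (v : 'rV[R]_n) : cons_rV (x, v) ord0 ord0 = x.
Proof.
have -> : ord0 = lshift n (ord0 : 'I_1) :> 'I_(1 + n) by exact/val_inj.
by apply: etrans (row_mxEl _ _ _ _) _; rewrite mxE.
Qed.

Lemma cons_rVS n (x : R) (v : 'rV[R]_n) i :
  cons_rV (x, v) ord0 (lift ord0 i) = v ord0 i.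
Proof.
have -> : lift ord0 i = rshift 1 i :> 'I_(1 + n) by exact/val_inj.
exact: row_mxEr.
Qed.

Lemma cons_rV_add0 n (x t : R) (v : 'rV[R]_n) :
  cons_rV (x, v) + t *: delta_mx ord0 ord0 = cons_rV (x + t, v).
Proof.
apply/rowP => j; rewrite [LHS]mxE [X in _ + X]mxE [delta_mx _ _ _ _]mxE eqxx/=.
by case: (unliftP ord0 j) => [k|] ->; rewrite ?cons_rVS ?cons_rV0 ?mulr0 ?mulr1 ?addr0.
Qed.

Lemma cons_rV_addS n (x t : R) (v : 'rV[R]_n) (i : 'I_n) :
  cons_rV (x, v) + t *: delta_mx ord0 (lift ord0 i) =
  cons_rV (x, v + t *: delta_mx ord0 i).
Proof.
apply/rowP => j; rewrite [LHS]mxE [X in _ + X]mxE [delta_mx _ _ _ _]mxE eqxx/=.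
case: (unliftP ord0 j) => [k|] ->; last by rewrite !cons_rV0 mulr0 addr0.
by rewrite !cons_rVS mxE [X in _ = _ + X]mxE mxE eqxx (inj_eq lift_inj).
Qed.

Lemma cons_rV_cube n M (x : R) (v : 'rV[R]_n) :
  cube M (cons_rV (x, v)) <-> `|x| <= M /\ cube M v.
Proof.
split=> [H|[xM vM] i].
  split; first by have := H ord0; rewrite cons_rV0 !mxE -ler_norml.
  by move=> i; have := H (lift ord0 i); rewrite cons_rVS !mxE.
case: (unliftP ord0 i) => [k|] ->; last by rewrite cons_rV0 !mxE -ler_norml.
by rewrite cons_rVS; have := vM k; rewrite !mxE.
Qed.

Lemma measurable_cons_rV2 n (x : measurableTypeR R) :
  measurable_fun setT (fun v : 'rV[R]_n => cons_rV (x, v)).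
Proof. exact: (measurable_fun_pair2 x (@measurable_cons_rV R n)). Qed.

(** Differentiability is required along lines only: in this form the hypotheses
    pass to the slices of [F] and [G], and Fubini's theorem reduces the claim to
    dimension one. *)
Lemma integral_line_derive_eq0 n (i : 'I_n) (F G : 'rV[R]_n -> R) (B M : R) :
  0 < M -> measurable_fun setT G -> (forall x, `|G x| <= B) ->
  (forall x, ~ cube M x -> F x = 0 /\ G x = 0) ->
  (forall x, continuous (fun t : R => G (x + t *: delta_mx ord0 i))) ->
  (forall x (t : R), is_derive t 1 (fun t => F (x + t *: delta_mx ord0 i))
     (G (x + t *: delta_mx ord0 i))) ->
  (\int[lebesgue_rV n]_x (G x)%:E = 0)%E.
Proof.
move=> M0; elim: n i F G => [[]//|n IH] i F G mG GB sup cG dF.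
have iG : (lebesgue_rV n.+1).-integrable setT (EFin \o G).
  by apply: integrable_bounded_support mG GB _ => x /sup[].
rewrite (integral_rV_succ iG).
have iGc := integrable_cons_rV iG.
case: (unliftP ord0 i) => [j|] ij; subst i.
  rewrite -(integral12_prod_meas1 iGc); apply: integral0_eq => x _.
  apply: (IH j (fun v => F (cons_rV (x, v))) (fun v => G (cons_rV (x, v)))).
  - by apply: measurableT_comp => //; exact: measurable_cons_rV2.
  - by move=> v; exact: GB.
  - by move=> v vM; apply: sup => /cons_rV_cube[].
  - by move=> v; under eq_fun do rewrite -cons_rV_addS; exact: cG.
  - by move=> v t; under eq_fun do rewrite -cons_rV_addS; rewrite -cons_rV_addS; exact: dF.
rewrite -(integral21_prod_meas1 iGc); apply: integral0_eq => v _.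
have E0 t : cons_rV (t, v) = cons_rV (0, v) + t *: delta_mx ord0 ord0.
  by rewrite cons_rV_add0 add0r.
apply: (@integral_derive_eq0 (fun t => F (cons_rV (t, v)))
    (fun t => G (cons_rV (t, v))) M M0).
- by move=> t; under eq_fun do rewrite E0; rewrite E0; exact: dF.
- by under eq_fun do rewrite E0; exact: cG.
- by move=> t tM; apply: sup => /cons_rV_cube[]; rewrite leNgt tM.
Qed.

End integral_of_derivative.

(** * Test functions *)

Section test_functions.
Context {R : realType} {n : nat}.
Implicit Types (h k g : 'rV[R]_n -> R) (Omega K : set 'rV[R]_n) (i : 'I_n).

Local Notation dir i := (delta_mx ord0 i : 'rV[R]_n).
Local Notation supp h := (closure [set x | h x != 0]).

Lemma smooth_continuous h : smooth h -> continuous h.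
Proof. by move=> /(_ [::])[]. Qed.

Lemma smooth_derivable h i x : smooth h -> derivable h x (dir i).
Proof. by move=> /(_ [::])[_]; exact. Qed.

Lemma smooth_partial h i : smooth h -> smooth (partial i h).
Proof. by move=> sh s; have := sh (rcons s i); rewrite -cats1 foldr_cat. Qed.

Lemma foldr_partialB h k s : smooth h -> smooth k ->
  foldr partial (h \- k) s = foldr partial h s \- foldr partial k s.
Proof.
move=> sh sk; elim: s => //= i s ->; apply/funext => x.
by rewrite /partial deriveB//; [case: (sh s)|case: (sk s)].
Qed.

Lemma partialB i h k x : smooth h -> smooth k ->
  partial i (h \- k) x = partial i h x - partial i k x.
Proof. by move=> sh sk; have := congr1 (@^~ x) (foldr_partialB [:: i] sh sk). Qed.

Lemma smoothB h k : smooth h -> smooth k -> smooth (h \- k).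
Proof.
move=> sh sk s; rewrite /= foldr_partialB//.
have [ch dh] := sh s; have [ck dk] := sk s; split.
  by move=> x; exact: (cvgB (ch x) (ck x)).
by move=> i x; exact: derivableB.
Qed.

Lemma test_funB Omega h k : test_fun Omega h -> test_fun Omega k ->
  test_fun Omega (h \- k).
Proof.
move=> [sh ch hO] [sk ck kO].
have sub : supp (h \- k) `<=` supp h `|` supp k.
  rewrite -closureU; apply: closure_subset => x /=.
  have [->|] := eqVneq (h x) 0; last by left.
  by rewrite sub0r oppr_eq0; right.
split; first exact: smoothB.
  apply: subclosed_compact sub; first exact: closed_closure.
  exact: compactU.
by move=> x /sub[/hO|/kO].
Qed.

Lemma supp_notin h x : ~ supp h x -> h x = 0.
Proof.
move=> hx; apply/eqP; apply: contrapT => /negP hx0; apply: hx.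
exact: subset_closure.
Qed.

Lemma partial_supp h i x : ~ supp h x -> partial i h x = 0.
Proof.
move=> hx; have oS : open (~` supp h) by exact/closed_openC/closed_closure.
rewrite /partial (@near_eq_derive _ _ _ h (cst 0)); first exact: derive_cst.
have := open_nbhs_nbhs (conj oS hx); apply: filterS => y; exact: supp_notin.
Qed.

Lemma gradB h k x : smooth h -> smooth k ->
  grad (h \- k) x = grad h x - grad k x.
Proof. by move=> sh sk; apply/rowP => i; rewrite !mxE partialB. Qed.

Lemma continuous_supp_bounded g K : continuous g -> compact K ->
  (forall x, ~ K x -> g x = 0) -> exists B : R, forall x, `|g x| <= B.
Proof.
move=> cg cK g0.
have := continuous_compact (continuous_subspaceT cg) cK.
move=> /compact_bounded[M [_ HM]]; exists (`|M| + 1) => x.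
have M1 : M < `|M| + 1 by rewrite (le_lt_trans (ler_norm M))// ltrDl.
have [Kx|Kx] := pselect (K x); last by rewrite g0// normr0 addr_ge0.
by apply: HM M1 _ _; exists x.
Qed.

Lemma compact_cube K : compact K -> exists2 M : R, 0 < M &
  K `<=` closed_box (const_mx (- M)) (const_mx M).
Proof. by move=> /compact_bounded /bounded_sub_box. Qed.

Lemma is_derive_line h i x (t : R) : smooth h ->
  is_derive t 1 (fun t => h (x + t *: dir i)) (partial i h (x + t *: dir i)).
Proof.
move=> sh; have := @smooth_derivable h i (x + t *: dir i) sh.
have E : (fun s => s^-1 *: ((h \o shift (x + t *: dir i)) (s *: dir i) -
      h (x + t *: dir i))) =
   (fun s => s^-1 *: (((fun t => h (x + t *: dir i)) \o shift t) (s *: (1 : R)) -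
      h (x + t *: dir i))).
  apply/funext => s /=; congr (_ *: (h _ - _)).
  by rewrite [s *: 1]mulr1 scalerDl addrCA.
by move=> dh; split; [rewrite /derivable -E|rewrite /partial /derive -E].
Qed.

Lemma continuous_line i (x : 'rV[R]_n) : continuous (fun t : R => x + t *: dir i).
Proof.
move=> t; apply: cvgD; first exact: cvg_cst.
by apply: cvgZr_tmp; exact: cvg_id.
Qed.

(** Integration by parts, the support of [k] being compact. *)
Lemma integral_partialM_eq0 Omega h k i : smooth h -> test_fun Omega k ->
  (\int[lebesgue_rV n]_x (h x * partial i k x + k x * partial i h x)%:E = 0)%E.
Proof.
move=> sh [sk ck _].
have [ch cdh] := (smooth_continuous sh, smooth_continuous (smooth_partial i sh)).
have [ck' cdk] := (smooth_continuous sk, smooth_continuous (smooth_partial i sk)).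
pose G x := h x * partial i k x + k x * partial i h x.
have cG : continuous G.
  move=> x; exact: (cvgD (cvgM (ch x) (cdk x)) (cvgM (ck' x) (cdh x))).
have G0 x : ~ supp k x -> G x = 0.
  by move=> xk; rewrite /G (partial_supp i xk) (supp_notin xk) mulr0 mul0r addr0.
have [B GB] := continuous_supp_bounded cG ck G0.
have [M M0 kM] := compact_cube ck.
apply: (@integral_line_derive_eq0 _ _ i (fun x => h x * k x) G B M M0) => //.
- exact: continuous_measurable_rVT.
- move=> x xM; have xk : ~ supp k x by move=> /kM; exact: xM.
  by rewrite (G0 _ xk) (supp_notin xk) mulr0.
- move=> x t.
  exact: (@continuous_comp _ _ _ (fun t : R => x + t *: dir i) G t
    (@continuous_line i x t) (cG _)).
- move=> x t; have dh := is_derive_line i x t sh; have dk := is_derive_line i x t sk.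
  exact: (is_deriveM dh dk).
Qed.

End test_functions.

(** * Smooth bumps *)

Section smooth_closure.
Context {R : realType} {n : nat}.
Implicit Types (h k g : 'rV[R]_n -> R) (i : 'I_n).

Local Notation dir i := (delta_mx ord0 i : 'rV[R]_n).

(** Coinduction for smoothness: iterated partial derivatives do not leave the
    class. *)
Lemma smooth_class (C : set ('rV[R]_n -> R)) :
  (forall g, C g -> [/\ continuous g, (forall i x, derivable g x (dir i)) &
     forall i, C (partial i g)]) ->
  forall g, C g -> smooth g.
Proof.
move=> HC g Cg s; suff : C (foldr partial g s) by move=> /HC[].
by elim: s => //= i s /HC[_ _]; exact.
Qed.

Lemma smooth_cst (c : R) : smooth (cst c : 'rV[R]_n -> R).
Proof.
apply: (@smooth_class [set g | exists c : R, g = cst c]); last by exists c.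
move=> _ [{}c ->]; split.
- exact: cst_continuous.
- by move=> i x; exact: derivable_cst.
- by move=> i; exists 0; apply/funext => x; rewrite /partial derive_cst.
Qed.

(** Sums of products of smooth functions, the class stable under the Leibniz
    rule. *)
Inductive sum_of_products : ('rV[R]_n -> R) -> Prop :=
| sop_prod h k : smooth h -> smooth k -> sum_of_products (h * k)
| sop_add g h : sum_of_products g -> sum_of_products h -> sum_of_products (g + h).

Lemma smoothM h k : smooth h -> smooth k -> smooth (h * k).
Proof.
move=> sh sk; apply: (@smooth_class sum_of_products); last exact: sop_prod.
move=> {h k sh sk} f; elim=> {f} [h k sh sk|g h _ [cg dg pg] _ [ch dh ph]].
  have [ch ck] := (smooth_continuous sh, smooth_continuous sk).
  split=> [x|i x|i]; first exact: (cvgM (ch x) (ck x)).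
    by apply: derivableM; exact: smooth_derivable.
  rewrite (_ : partial i (h * k) = h * partial i k + k * partial i h).
    exact: (sop_add (sop_prod sh (smooth_partial i sk))
      (sop_prod sk (smooth_partial i sh))).
  by apply/funext => x; rewrite /partial deriveM//; exact: smooth_derivable.
split=> [x|i x|i]; first exact: (cvgD (cg x) (ch x)).
  exact: derivableD.
rewrite (_ : partial i (g + h) = partial i g + partial i h).
  exact: sop_add.
by apply/funext => x; rewrite /partial deriveD.
Qed.

(** A partial derivative of [c * F m (x ord0 i)] has the same form, with [m + 1]
    in place of [m] and, in the directions other than [i], with the factor [0]. *)
Lemma smooth_coordinate (F : nat -> R -> R) (i : 'I_n) :
  (forall m (t : R), is_derive t 1 (F m) (F m.+1 t)) ->
  smooth (fun x : 'rV[R]_n => F 0%N (x ord0 i)).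
Proof.
move=> dF.
have cF m : continuous (F m).
  move=> t; apply: differentiable_continuous; apply/derivable1_diffP.
  by have := dF m t => -[].
pose C := [set g : 'rV[R]_n -> R | exists (c : R) m, g = fun x => c * F m (x ord0 i)].
apply: (@smooth_class C); last by exists 1, 0%N; apply/funext => x; rewrite mul1r.
move=> _ [c [m ->]].
have D j (x : 'rV[R]_n) : is_derive x (dir j)
    (fun x : 'rV[R]_n => c * F m (x ord0 i)) (c * (j == i)%:R * F m.+1 (x ord0 i)).
  have [->|ji] := eqVneq j i; last first.
    rewrite mulr0 mul0r.
    have E : (fun s : R => s^-1 *: (((fun x : 'rV[R]_n => c * F m (x ord0 i))
        \o shift x) (s *: dir j) - c * F m (x ord0 i))) = fun=> 0.
      apply/funext => s /=; rewrite !mxE eqxx eq_sym (negbTE ji) mulr0 add0r.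
      by rewrite subrr scaler0.
    split; rewrite /derivable /derive E; first exact: is_cvg_cst.
    exact: lim_cst.
  rewrite mulr1.
  have [dm em] := is_deriveZ c (dF m (x ord0 i)).
  have E : (fun s : R => s^-1 *: (((fun x : 'rV[R]_n => c * F m (x ord0 i))
        \o shift x) (s *: dir i) - c * F m (x ord0 i))) =
     (fun s : R => s^-1 *: (((c \*: F m) \o shift (x ord0 i)) (s *: (1 : R)) -
        (c \*: F m) (x ord0 i))).
    by apply/funext => s /=; rewrite !mxE !eqxx.
  split; first by rewrite /derivable E.
  by move: em; rewrite /derive E.
split.
- move=> x; apply: (@continuous_comp _ _ _ (fun x : 'rV[R]_n => x ord0 i)
    (fun t : R => c * F m t)); first exact: coord_continuous.
  exact: (cvgM (cvg_cst c) (cF m _)).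
- by move=> j x; have [] := D j x.
- move=> j; exists (c * (j == i)%:R), m.+1; apply/funext => x.
  by have [] := D j x.
Qed.

End smooth_closure.

Section flat_function.
Context {R : realType}.
Implicit Types (P : {poly R}) (x : R).

(** [P(1/x) exp(-1/x)], extended by [0]: with [P = 1] the standard smooth
    function that is flat at the origin; the polynomial [P] makes the class
    stable under differentiation. *)
Definition flat P x : R := if 0 < x then P.[x^-1] * expR (- x^-1) else 0.

(** For [y >= 1] the term of degree [m + 1] of the exponential series already
    dominates [y ^+ m] up to a factor. *)
Lemma expR_dominates m : exists2 C : R, 0 <= C &
  forall y : R, 0 < y -> y ^+ m * expR (- y) <= C.
Proof.
exists (m.+1`!%:R + 1); first by rewrite addr_ge0.
move=> y y0; rewrite expRN ler_pdivrMr ?expR_gt0//.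
have h := expR_ge1Dxn m (ltW y0).
have f0 : 0 < m.+1`!%:R :> R by rewrite ltr0n fact_gt0.
have {}h : m.+1`!%:R + y ^+ m.+1 <= m.+1`!%:R * expR y.
  apply: le_trans (ler_wpM2l (ltW f0) h).
  by rewrite mulrDr mulr1 mulrCA divff ?gt_eqF// mulr1.
apply: (@le_trans _ _ (1 + y ^+ m.+1)).
  have [y1|/ltW y1] := leP y 1.
    by rewrite (@le_trans _ _ 1) ?exprn_ile1 ?(ltW y0)// lerDl exprn_ge0 ?ltW.
  by rewrite exprS (@le_trans _ _ (y * y ^+ m))// ?lerDr// ler_peMl// exprn_ge0// ltW.
have := expR_ge1Dx y; have f1 : 1 <= m.+1`!%:R :> R by rewrite ler1n fact_gt0.
by move: h f1; rewrite mulrDl mul1r; lra.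
Qed.

Lemma poly_expR_dominated P m : exists2 C : R, 0 <= C &
  forall y : R, 0 < y -> `|P.[y]| * y ^+ m * expR (- y) <= C.
Proof.
elim/poly_ind: P m => [|P c IH] m.
  by exists 0 => // y _; rewrite horner0 normr0 !mul0r.
have [A A0 HA] := IH m.+1; have [B B0 HB] := expR_dominates m.
exists (A + `|c| * B); first by rewrite addr_ge0// mulr_ge0.
move=> y y0; rewrite hornerMXaddC.
apply: (@le_trans _ _ (`|P.[y]| * y ^+ m.+1 * expR (- y) +
    `|c| * (y ^+ m * expR (- y)))); last by rewrite lerD ?HA ?ler_wpM2l ?HB.
rewrite [leRHS](_ : _ = (`|P.[y]| * y + `|c|) * y ^+ m * expR (- y)); last first.
  by rewrite exprS; ring.
apply: ler_wpM2r; first exact: expR_ge0.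
apply: ler_wpM2r; first by rewrite exprn_ge0// ltW.
by rewrite (le_trans (ler_normD _ _))// normrM (gtr0_norm y0).
Qed.

(** Vanishing to second order, which makes the derivative at the origin [0]. *)
Lemma flat_le P : exists2 C : R, 0 <= C & forall x, `|flat P x| <= C * x ^+ 2.
Proof.
have [C C0 HC] := poly_expR_dominated P 2.
exists C => // x; rewrite /flat; case: ifPn => x0; last first.
  by rewrite normr0 mulr_ge0 ?sqr_ge0.
have := HC x^-1; rewrite invr_gt0 => /(_ x0).
rewrite normrM (ger0_norm (expR_ge0 _)) mulrAC exprVn ler_pdivrMr// exprn_gt0//.
Qed.

Definition flat_step P : {poly R} := 'X^2 * (P - P^`()).

Lemma is_derive_flat P x : is_derive x 1 (flat P) (flat (flat_step P) x).
Proof.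
have [x0|x0|<-] := ltgtP 0 x.
- have dV : is_derive x 1 (fun y : R => y^-1) (- x ^- 2 *: 1).
    by apply: (@is_deriveV R id x 1 1); rewrite gt_eqF.
  have dP := is_derive1_comp (is_derive_poly P x^-1) dV.
  have dE := @is_derive1_comp R expR (fun y => - y^-1) x _ _
    (is_derive_expR (- x^-1)) (is_deriveN dV).
  have dPE := is_deriveM dP dE.
  have Ed : flat (flat_step P) x = P.[x^-1] *: (expR (- x^-1) * - (- x ^- 2 *: 1))
      + expR (- x^-1) *: (P^`().[x^-1] * (- x ^- 2 *: 1)).
    rewrite /flat x0 /flat_step !(hornerE, hornerXn) /GRing.scale/= -exprVn.
    ring.
  rewrite Ed; apply: near_eq_is_derive dPE.
  have := open_nbhs_nbhs (conj (@open_gt R 0) x0).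
  by apply: filterS => y y0; rewrite /flat y0.
- have Ex : flat (flat_step P) x = 0 by rewrite /flat ltNge (ltW x0).
  rewrite Ex; apply: near_eq_is_derive (is_derive_cst 0 x 1).
  have := open_nbhs_nbhs (conj (@open_lt R 0) x0).
  by apply: filterS => y y0; rewrite /flat ltNge (ltW y0).
- have -> : flat (flat_step P) 0 = 0 by rewrite /flat ltxx.
  have [C C0 HC] := flat_le P.
  suff H : (fun s : R => s^-1 *: ((flat P \o shift 0) (s *: (1 : R)) - flat P 0))
      @ 0^' --> (0 : R).
    by split; [apply/cvg_ex; exists 0|exact: cvg_lim].
  have C1 : 0 < C + 1 by rewrite ltr_wpDl.
  apply/cvgr0Pnorm_le => e e0; near=> s.
  have F0 : flat P 0 = 0 by rewrite /flat ltxx.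
  rewrite /= addr0 F0 subr0 [s *: 1]mulr1 normrZ normfV.
  have se : `|s| <= e / (C + 1).
    by near: s; exact: (dnbhs0_le (divr_gt0 e0 C1)).
  have [->|s0] := eqVneq s 0; first by rewrite normr0 invr0 mul0r ltW.
  rewrite ler_pdivrMl ?normr_gt0// (le_trans (HC s))//.
  rewrite -(real_normK (num_real s)) expr2 mulrCA ler_wpM2l//.
  apply: le_trans (ler_wpM2l C0 se) _.
  by rewrite mulrCA ler_piMr ?(ltW e0)// ler_pdivrMr// mul1r lerDl.
Unshelve. all: by end_near.
Qed.

End flat_function.

Section bumps.
Context {R : realType} {n : nat}.
Implicit Types (a b x : 'rV[R]_n) (k : R) (i : 'I_n).

Local Notation flat1 := (flat (1 : {poly R})).

Lemma flat1E (t : R) : flat1 t = if 0 < t then expR (- t^-1) else 0.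
Proof. by rewrite /flat hornerC mul1r. Qed.

Lemma flat1_ge0 (t : R) : 0 <= flat1 t.
Proof. by rewrite flat1E; case: ifP => // _; exact: expR_ge0. Qed.

Lemma flat1_le1 (t : R) : flat1 t <= 1.
Proof.
rewrite flat1E; case: ifPn => // t0.
by rewrite -expR0 ler_expR oppr_le0 invr_ge0 ltW.
Qed.

Lemma smooth_flat_affine (c d : R) i :
  smooth (fun x : 'rV[R]_n => flat1 (c * x ord0 i + d)).
Proof.
pose F m (t : R) := c ^+ m * flat (iter m flat_step 1) (c * t + d).
rewrite (_ : (fun _ => _) = fun x : 'rV[R]_n => F 0%N (x ord0 i)); last first.
  by apply/funext => x; rewrite /F expr0 mul1r.
apply: smooth_coordinate => m t.
have dA : is_derive t 1 (fun t => c * t + d) c.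
  have := is_deriveD (is_deriveZ c (is_derive_id t 1)) (is_derive_cst d t 1).
  by rewrite addr0 [c *: 1]mulr1.
have := is_deriveZ (c ^+ m) (@is_derive1_comp R (flat (iter m flat_step 1)) _ t _ _
  (is_derive_flat (iter m flat_step 1) (c * t + d)) dA).
rewrite (_ : _ *: (_ * c) = F m.+1 t)//.
by rewrite /F exprS /GRing.scale/=; ring.
Qed.

(** A smooth function with values in [[0, 1]] that is positive exactly on the
    open box, and increases to its indicator as [k] grows. *)
Definition bump a b k x : R :=
  \prod_(i < n) (flat1 (k * (x ord0 i - a ord0 i)) * flat1 (k * (b ord0 i - x ord0 i))).

Lemma smooth_bump a b k : smooth (bump a b k).
Proof.
rewrite (_ : bump a b k = \prod_(i < n) ((fun x : 'rV[R]_n =>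
    flat1 (k * x ord0 i + - (k * a ord0 i))) * (fun x : 'rV[R]_n =>
    flat1 (- k * x ord0 i + k * b ord0 i)))); last first.
  apply/funext => x; rewrite fct_prodE; apply: eq_bigr => i _.
  congr (flat1 _ * flat1 _); ring.
elim/big_ind : _ => [|f g sf sg|i _]; first exact: smooth_cst.
  exact: smoothM.
by apply: smoothM; exact: smooth_flat_affine.
Qed.

Lemma bump_ge0 a b k x : 0 <= bump a b k x.
Proof. by apply: prodr_ge0 => i _; rewrite mulr_ge0 ?flat1_ge0. Qed.

Lemma bump_le1 a b k x : bump a b k x <= 1.
Proof.
apply: prodr_ile1 => i _.
by rewrite mulr_ge0 ?flat1_ge0//= mulr_ile1 ?flat1_ge0 ?flat1_le1.
Qed.

Lemma bump_notin a b k x : 0 < k -> ~ open_box a b x -> bump a b k x = 0.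
Proof.
move=> k0 /existsNP[i]; rewrite /bump (bigD1 i)//=.
move=> /negP; rewrite negb_and -!leNgt => /orP[xa|bx].
  by rewrite [flat1 (k * (x ord0 i - _))]flat1E pmulr_rgt0// subr_gt0 ltNge xa !mul0r.
by rewrite [flat1 (k * (b ord0 i - _))]flat1E pmulr_rgt0// subr_gt0 ltNge bx mulr0 mul0r.
Qed.

Lemma test_fun_bump Omega a b k : 0 < k -> closed_box a b `<=` Omega ->
  test_fun Omega (bump a b k).
Proof.
move=> k0 abO.
have sub : closure [set x | bump a b k x != 0] `<=` closed_box a b.
  have cab : closed (closed_box a b).
    by apply: compact_closed; [exact: norm_hausdorff|exact: compact_closed_box].
  rewrite [X in _ `<=` X]((closure_id _).1 cab); apply: closure_subset => x /= bx.
  apply: open_box_sub; apply: contrapT => xab.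
  by move: bx; rewrite bump_notin// eqxx.
split; first exact: smooth_bump.
  apply: subclosed_compact sub; first exact: closed_closure.
  exact: compact_closed_box.
exact: subset_trans sub abO.
Qed.

Lemma cvg_flat1 (t : R) : 0 < t -> (fun m : nat => flat1 (m.+1%:R * t)) @ \oo --> (1 : R).
Proof.
move=> t0; rewrite (_ : (fun _ => _) = fun m : nat => expR (- (t^-1 * m.+1%:R^-1))).
  rewrite -[X in _ --> X]expR0.
  apply: (@continuous_cvg _ _ _ _ _ _ expR); first exact: continuous_expR.
  rewrite -oppr0; apply: cvgN; rewrite -(mulr0 t^-1).
  exact: (cvgM (cvg_cst _) (@cvg_harmonic R)).
by apply/funext => m; rewrite flat1E mulr_gt0// invfM mulrC.
Qed.

Lemma cvg_bump a b x :
  (fun m : nat => bump a b m.+1%:R x) @ \oo --> (\1_(open_box a b) x : R).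
Proof.
rewrite indicE; have [xab|xab] := boolP (x \in open_box a b); last first.
  rewrite (_ : (fun _ => _) = fun=> 0); first exact: cvg_cst.
  by apply/funext => m; rewrite bump_notin// => h; move/negP : xab; rewrite inE.
rewrite -[X in _ --> X](@big1_eq _ 1 *%R _ (index_enum 'I_n) xpredT).
move: xab; rewrite inE => xab.
rewrite /bump; elim: (index_enum 'I_n) => [|i s IH].
  rewrite big_nil (_ : (fun _ => _) = fun=> 1); first exact: cvg_cst.
  by apply/funext => m; rewrite big_nil.
rewrite big_cons; under eq_fun do rewrite big_cons.
have /andP[ax xb] := xab i; rewrite -subr_gt0 in ax; rewrite -subr_gt0 in xb.
have P := cvgM (cvg_flat1 ax) (cvg_flat1 xb).
have := cvgM (P _) IH; rewrite (mulr1 1) => H; exact: H.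
Qed.

End bumps.

(** * The fundamental lemma of the calculus of variations *)

Section du_bois_reymond.
Context {R : realType} {n : nat}.
Implicit Types (g : 'rV[R]_n -> R) (Omega : set 'rV[R]_n) (a b : 'rV[R]_n).

Local Notation mu := (lebesgue_rV n : set 'rV[R]_n -> \bar R).

Definition open_boxes : set (set 'rV[R]_n) :=
  [set A | exists a b, A = open_box a b].

Lemma open_boxI a b a' b' : open_box a b `&` open_box a' b' =
  open_box (\row_i maxr (a ord0 i) (a' ord0 i)) (\row_i minr (b ord0 i) (b' ord0 i)).
Proof.
apply/seteqP; split => x /=.
  move=> [H H'] i; rewrite !mxE gt_max lt_min.
  by have /andP[-> ->] := H i; have /andP[-> ->] := H' i.
move=> H; split => i; have := H i; rewrite !mxE gt_max lt_min.
  by move=> /andP[/andP[-> _] /andP[-> _]].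
by move=> /andP[/andP[_ ->] /andP[_ ->]].
Qed.

Lemma closed_boxI_sub a b a' b' :
  closed_box (\row_i maxr (a ord0 i) (a' ord0 i)) (\row_i minr (b ord0 i) (b' ord0 i))
  `<=` closed_box a b.
Proof.
move=> x H i; have := H i; rewrite !mxE ge_max le_min.
by move=> /andP[/andP[-> _] /andP[-> _]].
Qed.

(** A coordinate half-space is an increasing union of open boxes. *)
Lemma measurable_open_boxes : @measurable _ 'rV[R]_n = <<s open_boxes >>.
Proof.
apply/seteqP; split; last first.
  apply: smallest_sub; first exact: sigma_algebra_measurable.
  by move=> _ [a [b ->]]; exact: measurable_open_box.
apply: smallest_sub; first exact: smallest_sigma_algebra.
rewrite -bigcup_seq/=; apply: bigcup_sub => i _ _ [B mB <-].
pose T := g_sigma_algebraType open_boxes.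
suff : measurable_fun (setT : set T) (fun v : T => (v : 'rV[R]_n) ord0 i).
  by move=> /(_ measurableT B mB).
apply: (measurability _ (RGenOInfty.measurableE R)) => //.
move=> _ [_ [c ->] <-]; rewrite setTI.
rewrite [X in measurable X](_ : _ = \bigcup_(m : nat)
    open_box (\row_j if j == i then c else - m%:R) (const_mx m%:R)).
  apply: (@bigcupT_measurable _ T) => m; apply: sub_sigma_algebra.
  by eexists; eexists.
apply/seteqP; split => x.
  rewrite /= in_itv/= andbT => cx.
  have [m xm] : exists m : nat, forall j, `|x ord0 j| < m%:R.
    exists (Num.trunc (\sum_j `|x ord0 j|)).+1 => j.
    apply: le_lt_trans (truncnS_gt _).
    by rewrite (bigD1 j)//= lerDl sumr_ge0.
  exists m => // j; rewrite !mxE.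
  have := xm j; rewrite ltr_norml => /andP[h1 h2].
  by rewrite h2 andbT; case: eqP => // ->.
move=> [m _ /(_ i)]; rewrite !mxE eqxx => /andP[+ _].
by rewrite /= in_itv/= andbT.
Qed.

(** The bumps of the box are test functions and converge boundedly to its
    indicator. *)
Lemma integral_open_box_eq0 Omega g a b : open Omega ->
  loc_integrable Omega g ->
  (forall h, test_fun Omega h ->
     \int[lebesgue_rV n]_(x in Omega) (g x * h x) = 0) ->
  closed_box a b `<=` Omega ->
  (\int[lebesgue_rV n]_(x in open_box a b) (g x)%:E = 0)%E.
Proof.
move=> oO [mg ig] H abO.
have iK := ig _ (@compact_closed_box _ _ a b) abO.
have mK : measurable (closed_box a b) := measurable_closed_box a b.
have mB := measurable_open_box a b.
have mgK : measurable_fun (closed_box a b) g.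
  exact: measurable_funS (open_measurable_rV oO) abO mg.
pose h m := bump a b (m.+1%:R : R).
have th m : test_fun Omega (h m) by apply: test_fun_bump.
have ch m : measurable_fun (closed_box a b) (h m).
  apply: measurable_funTS; apply: continuous_measurable_rVT.
  by have [/smooth_continuous] := th m.
have I0 m : (\int[lebesgue_rV n]_(x in closed_box a b) (g x * h m x)%:E = 0)%E.
  have ih : (lebesgue_rV n).-integrable (closed_box a b)
      (fun x => (g x * h m x)%:E).
    apply: le_integrable iK => //.
      exact/measurable_EFinP/measurable_funM.
    move=> x _ /=; rewrite lee_fin normrM ler_piMr//.
    by rewrite ger0_norm ?bump_ge0 ?bump_le1.
  have := H _ (th m); rewrite /Rintegral [X in fine X](_ : _ =
    \int[lebesgue_rV n]_(x in closed_box a b) (g x * h m x)%:E)%E.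
    by move=> H0; rewrite -[LHS]fineK ?H0//; exact: integrable_fin_num.
  rewrite integral_mkcond [RHS]integral_mkcond; apply: eq_integral => x _.
  rewrite !patchE; have [xK|xK] := boolP (x \in closed_box a b).
    by rewrite (_ : x \in Omega)//; move: xK; rewrite !inE => /abO.
  case: ifP => // _; rewrite /h bump_notin ?mulr0//.
  by move=> /open_box_sub xab; move/negP: xK; rewrite inE.
have [|||||_ _ +] := @dominated_convergence _ _ _ (lebesgue_rV n) _ mK
  (fun m x => (g x * h m x)%:E) (fun x => (g x * \1_(open_box a b) x)%:E)
  (fun x => `|(g x)%:E|%E).
- by move=> m; exact/measurable_EFinP/measurable_funM.
- exact/measurable_EFinP/measurable_funM.
- apply: aeW => x _; apply: cvg_EFin; first exact: nearW.
  by apply: cvgM; [exact: cvg_cst|exact: cvg_bump].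
- exact: integrable_abse.
- apply: aeW => x m _ /=; rewrite lee_fin normrM ler_piMr//.
  by rewrite ger0_norm ?bump_ge0 ?bump_le1.
rewrite (_ : [sequence _]_n = fun=> 0%E); last by apply/funext => m; exact: I0.
move=> /(cvg_lim (@ereal_hausdorff R)); rewrite lim_cst//.
move=> E.
rewrite [LHS](_ : _ = \int[lebesgue_rV n]_(x in closed_box a b)
  (g x * \1_(open_box a b) x)%:E)%E; first by rewrite -E.
rewrite integral_mkcond [RHS]integral_mkcond; apply: eq_integral => x _.
rewrite !patchE indicE; case: ifPn => xB; case: ifPn => xK //.
- by rewrite mulr1.
- by move/negP: xK; rewrite !inE in xB *; move=> /(_ (open_box_sub xB)).
- by rewrite mulr0.
Qed.

Lemma integral_sub_box_eq0 Omega g a0 b0 A : open Omega ->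
  loc_integrable Omega g ->
  (forall h, test_fun Omega h ->
     \int[lebesgue_rV n]_(x in Omega) (g x * h x) = 0) ->
  closed_box a0 b0 `<=` Omega -> measurable A ->
  (\int[lebesgue_rV n]_(x in A `&` open_box a0 b0) (g x)%:E = 0)%E.
Proof.
move=> oO lg H abO; have [mg ig] := lg.
have mB := measurable_open_box a0 b0.
have iB : (lebesgue_rV n).-integrable (open_box a0 b0) (EFin \o g).
  apply: integrableS (ig _ (@compact_closed_box _ _ a0 b0) abO) => //.
    exact: measurable_closed_box.
  exact: open_box_sub.
have B0 := integral_open_box_eq0 oO lg H abO.
pose P A := (\int[lebesgue_rV n]_(x in A `&` open_box a0 b0) (g x)%:E = 0)%E.
have iS C : measurable C -> (lebesgue_rV n).-integrable (C `&` open_box a0 b0) (EFin \o g).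
  by move=> mC; apply: integrableS iB => //; exact: measurableI.
rewrite measurable_open_boxes => sA.
apply: (@dynkin_induction _ _ open_boxes P measurable_open_boxes) sA => //.
- move=> _ _ [a [b ->]] [a' [b' ->]]; rewrite open_boxI.
  by eexists; eexists.
- by rewrite /P setTI.
- move=> _ [a [b ->]]; rewrite /P setIC open_boxI.
  apply: (integral_open_box_eq0 oO lg H).
  by apply: subset_trans abO; exact: closed_boxI_sub.
- move=> S mS PS; rewrite /P.
  have mS' : measurable (~` S) by exact: measurableC.
  have E : open_box a0 b0 = (S `&` open_box a0 b0) `|` (~` S `&` open_box a0 b0).
    by rewrite -setIUl setUCr setTI.
  have <- : (\int[lebesgue_rV n]_(x in open_box a0 b0) (g x)%:E = 0)%E by [].
  rewrite [in RHS]E integral_setU//.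
  + by rewrite [X in (X + _)%E]PS add0e.
  + exact: measurableI.
  + exact: measurableI.
  + by rewrite -E; exact: measurable_int iB.
  + by apply/disj_setPS => x [[Sx _] [nSx _]]; exact: nSx.
- move=> F mF tF PF; rewrite /P setI_bigcupl integral_bigcup.
  + by rewrite eseries0// => k _ _; exact: PF.
  + exact: trivIset_setIr.
  + by move=> k; exact: measurableI.
  + by rewrite -setI_bigcupl; apply: iS; exact: bigcupT_measurable.
Qed.

(** The fundamental lemma of the calculus of variations. On a box inside the
    domain the sets of zero integral form a lambda-system containing the open
    boxes, whose indicators are limits of bumps. *)
Lemma du_bois_reymond Omega g : open Omega -> loc_integrable Omega g ->
  (forall h, test_fun Omega h ->
     \int[lebesgue_rV n]_(x in Omega) (g x * h x) = 0) ->
  {ae lebesgue_rV n, forall x, Omega x -> g x = 0}.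
Proof.
move=> oO lg H; have [mg ig] := lg.
pose Q (ab : 'rV[rat]_n * 'rV[rat]_n) (x : 'rV[R]_n) :=
  closed_box (ratr_rV ab.1) (ratr_rV ab.2) `<=` Omega ->
  open_box (ratr_rV ab.1) (ratr_rV ab.2) x -> g x = 0.
have HQ ab : {ae lebesgue_rV n, forall x, Q ab x}.
  have [abO|abO] := pselect
    (closed_box (ratr_rV ab.1) (ratr_rV ab.2) `<=` (Omega : set 'rV[R]_n)); last first.
    by apply: aeW => x abO'; exfalso; exact: abO.
  have mB := measurable_open_box (@ratr_rV R _ ab.1) (ratr_rV ab.2).
  have iB : (lebesgue_rV n).-integrable
      (open_box (ratr_rV ab.1) (ratr_rV ab.2)) (EFin \o g).
    apply: integrableS (ig _ (@compact_closed_box _ _ _ _) abO) => //.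
      exact: measurable_closed_box.
    exact: open_box_sub.
  have : ae_eq (lebesgue_rV n) (open_box (ratr_rV ab.1) (ratr_rV ab.2))
      (EFin \o g) (cst 0%E).
    apply: integral_ae_eq => //.
    move=> E EB mE; rewrite integral0 -(setIidl EB).
    exact: (integral_sub_box_eq0 oO lg H abO).
  by apply: filterS => x gx _ /gx [].
have : {ae lebesgue_rV n, forall x, forall m, if unpickle m is Some ab then Q ab x else True}.
  apply/ae_foralln => m; case: (unpickle m) => [ab|]; first exact: HQ.
  exact: aeW.
apply: filterS => x Hx Ox; have [a [b [xab abO]]] := open_rational_box oO Ox.
by have := Hx (pickle (a, b)); rewrite pickleK; exact.
Qed.

End du_bois_reymond.

(** * Weak gradients *)

Section weak_gradients.
Context {R : realType} {n : nat}.
Variable Omega : set 'rV[R]_n.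
Hypothesis Omega_open : open Omega.
Implicit Types (u v h g : 'rV[R]_n -> R) (G H : 'rV[R]_n -> 'rV[R]_n).

Local Notation mu := (lebesgue_rV n).

Let mO : measurable Omega. Proof. exact: open_measurable_rV. Qed.

Lemma loc_integrableM u g K : loc_integrable Omega u -> continuous g ->
  compact K -> K `<=` Omega -> (forall x, ~ K x -> g x = 0) ->
  mu.-integrable Omega (EFin \o (fun x => u x * g x)).
Proof.
move=> [mu_ iu] cg cK KO g0.
have [B gB] := continuous_supp_bounded cg cK g0.
have mK := compact_measurable_rV cK.
have mg : measurable_fun Omega g.
  by apply: measurable_funTS; exact: continuous_measurable_rVT.
have mug : measurable_fun Omega (fun x => u x * g x) by exact: measurable_funM.
have iK : mu.-integrable K (EFin \o (fun x => u x * g x)).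
  apply: (@le_integrable _ _ _ _ _ mK _ (fun x => (B%:E * (u x)%:E)%E)).
  - by apply/measurable_EFinP; exact: measurable_funS mO KO mug.
  - move=> x _ /=; rewrite lee_fin !normrM mulrC ler_wpM2r//.
    exact: le_trans (gB x) (ler_norm _).
  - by apply: integrableZl => //; exact: iu.
have : mu.-integrable setT (EFin \o (fun x => u x * g x) \_ K).
  by rewrite -restrict_EFin; apply/(integrable_mkcond _ mK).
rewrite (_ : _ \_ K = (fun x => u x * g x)).
  by apply: integrableS.
apply/funext => x; rewrite patchE; case: ifPn => // xK.
by rewrite g0 ?mulr0// => Kx; move/negP: xK; rewrite inE.
Qed.

Lemma loc_integrableB u v : loc_integrable Omega u -> loc_integrable Omega v ->
  loc_integrable Omega (u \- v).
Proof.
move=> [mu_ iu] [mv iv]; split; first exact: measurable_funB.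
move=> K cK KO; have mK := compact_measurable_rV cK.
exact: (integrableRB mK (iu K cK KO) (iv K cK KO)).
Qed.

Lemma test_fun_weak_integrable u h : loc_integrable Omega u ->
  test_fun Omega h -> mu.-integrable Omega (EFin \o (fun x => u x * h x)).
Proof.
move=> lu [sh ch hO].
by apply: loc_integrableM (smooth_continuous sh) ch hO _ => // x; exact: supp_notin.
Qed.

Lemma partial_weak_integrable u h i : loc_integrable Omega u ->
  test_fun Omega h ->
  mu.-integrable Omega (EFin \o (fun x => u x * partial i h x)).
Proof.
move=> lu [sh ch hO]; have cp := smooth_continuous (smooth_partial i sh).
by apply: loc_integrableM cp ch hO _ => // x; exact: partial_supp.
Qed.

Lemma is_weak_gradB u v G H : is_weak_grad Omega u G -> is_weak_grad Omega v H ->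
  is_weak_grad Omega (u \- v) (fun x => G x - H x).
Proof.
move=> [lu uG] [lv vH]; split; first exact: loc_integrableB.
move=> i; have [lG HG] := uG i; have [lH HH] := vH i.
have E : (fun x => (G x - H x) ord0 i) = (fun x => G x ord0 i) \- (fun x => H x ord0 i).
  by apply/funext => x; rewrite !mxE.
split; first by rewrite E; exact: loc_integrableB.
move=> h th.
under eq_Rintegral do rewrite mulrBl.
rewrite RintegralB//; [|exact: partial_weak_integrable..].
under [in RHS]eq_Rintegral do rewrite (congr1 (@^~ _) E) mulrBl.
rewrite RintegralB//; [|exact: test_fun_weak_integrable..].
by rewrite HG// HH// opprB opprK addrC.
Qed.

Lemma weak_grad_unique u G H : is_weak_grad Omega u G -> is_weak_grad Omega u H ->
  {ae mu, forall x, Omega x -> G x = H x}.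
Proof.
move=> [lu uG] [_ uH].
have : {ae mu, forall x, forall i : 'I_n, Omega x -> G x ord0 i - H x ord0 i = 0}.
  apply: filter_forall => i; have [lG HG] := uG i; have [lH HH] := uH i.
  apply: (du_bois_reymond Omega_open (g := fun x => G x ord0 i - H x ord0 i)).
    exact: loc_integrableB.
  move=> h th; under eq_Rintegral do rewrite mulrBl.
  rewrite RintegralB//; [|exact: test_fun_weak_integrable..].
  by apply: oppr_inj; rewrite oppr0 opprB -[X in X - _]opprK -HH// HG// opprK subrr.
apply: filterS => x GH Ox; apply/rowP => i; apply/eqP.
by rewrite -subr_eq0; apply/eqP; exact: GH.
Qed.

Lemma is_weak_grad_wgrad u G : is_weak_grad Omega u G ->
  is_weak_grad Omega u (wgrad Omega u).
Proof. by move=> uG; apply: xgetPex; exists G. Qed.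

Lemma wgradB_ae u v G H : is_weak_grad Omega u G -> is_weak_grad Omega v H ->
  {ae mu, forall x, Omega x -> wgrad Omega (u \- v) x = G x - H x}.
Proof.
move=> uG vH; have uvGH := is_weak_gradB uG vH.
exact: weak_grad_unique (is_weak_grad_wgrad uvGH) uvGH.
Qed.

Lemma continuous_loc_integrable g : continuous g -> loc_integrable Omega g.
Proof.
move=> cg; have mg := continuous_measurable_rVT cg.
split; first exact: measurable_funTS.
move=> K cK KO; have mK := compact_measurable_rV cK.
have := continuous_compact (continuous_subspaceT cg) cK.
move=> /compact_bounded[M [_ HM]].
apply: measurable_bounded_integrable => //.
- by apply: bounded_finite => //; exact: compact_bounded.
- exact: measurable_funTS.
- exists M; split; first by rewrite num_real.
  by move=> N MN x Kx; apply: HM MN _ _; exists x.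
Qed.

Lemma test_fun_is_weak_grad h : test_fun Omega h -> is_weak_grad Omega h (grad h).
Proof.
move=> th; have [sh ch hO] := th; have c_h := smooth_continuous sh.
split; first exact: continuous_loc_integrable.
move=> i; have cp := smooth_continuous (smooth_partial i sh).
have E : (fun x => grad h x ord0 i) = partial i h.
  by apply/funext => x; rewrite !mxE.
have lp : loc_integrable Omega (partial i h) by exact: continuous_loc_integrable.
split; first by rewrite E.
move=> k tk; have [sk ck kO] := tk.
under [in RHS]eq_Rintegral do rewrite (congr1 (@^~ _) E).
apply/eqP; rewrite -addr_eq0 -RintegralD//; last 2 first.
- by apply: partial_weak_integrable => //; exact: continuous_loc_integrable.
- exact: test_fun_weak_integrable.
apply/eqP; have := integral_partialM_eq0 i sh tk.
rewrite /Rintegral => I0; rewrite [X in fine X](_ : _ = 0%E)// -[RHS]I0.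
rewrite integral_mkcond; apply: eq_integral => x _; rewrite patchE.
case: ifPn => xO; first by rewrite [k x * _]mulrC.
have xk : ~ closure [set x | k x != 0] x.
  by move=> /kO Ox; move/negP: xO; rewrite inE.
by rewrite (supp_notin xk) (partial_supp i xk) mulr0 mul0r addr0.
Qed.

End weak_gradients.

(** * Sobolev functions with variable exponents *)

Section sobolev_modulars.
Context {R : realType} {n : nat}.
Variable Omega : set 'rV[R]_n.
Hypotheses (Omega_open : open Omega) (Omega_bounded : bounded_set Omega).
Implicit Types (q u v h : 'rV[R]_n -> R) (X : 'rV[R]_n -> 'rV[R]_n).

Local Notation mu := (lebesgue_rV n).

Let mO : measurable Omega. Proof. exact: open_measurable_rV. Qed.

Let Omega_fin : (mu Omega < +oo)%E. Proof. exact: bounded_finite. Qed.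

Lemma weak_grad_measurable u G : is_weak_grad Omega u G ->
  measurable_field Omega G.
Proof. by move=> [_ uG] i; have [[mG _] _] := uG i. Qed.

Lemma W1_weak_grad q u : W1 Omega q u -> is_weak_grad Omega u (wgrad Omega u).
Proof. by move=> [_ [G uG] _]; exact: is_weak_grad_wgrad uG. Qed.

(** Membership in [Lq] only bounds the modular of some multiple of the gradient;
    the multiple can be removed when the exponent is bounded. *)
Lemma W1_finite_modularZ q u : measurable_fun Omega q -> W1 Omega q u ->
  exists2 l : R, 0 < l &
    finite_modular mu Omega q (fun x => l *: wgrad Omega u x).
Proof.
move=> mq W1u; have mG := weak_grad_measurable (W1_weak_grad W1u).
have [_ _ [_ [l l0 lfin]]] := W1u; exists l => //.
have mlG := measurable_fieldZ l mG; split => //.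
apply/integrableP; split.
  exact/measurable_EFinP/measurable_powR_enorm.
apply: le_lt_trans lfin; rewrite le_eqVlt; apply/orP; left; apply/eqP.
apply: eq_integral => x _ /=; rewrite ger0_norm ?powR_ge0//.
by rewrite enormZ ?(ltW l0)// ger0_norm// mulr_ge0 ?enorm_ge0 ?ltW.
Qed.

Lemma finite_modular_unscale q (b l : R) X : measurable_fun Omega q ->
  (forall x, Omega x -> 0 < q x <= b) -> 0 < l ->
  finite_modular mu Omega q (fun x => l *: X x) -> finite_modular mu Omega q X.
Proof.
move=> mq qb l0 [mlX ilX].
have l0' := ltW l0.
have mX : measurable_field Omega X.
  have := measurable_fieldZ l^-1 mlX.
  rewrite (_ : (fun _ => _) = X)//; apply/funext => x.
  by rewrite scalerA mulVf ?gt_eqF// scale1r.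
split; first exact: mX.
apply: integrableR_le (integrableRZ mO (1 + l^-1 `^ b) ilX) _ => //.
  exact: measurable_powR_enorm.
move=> x Ox; have /andP[q0 qxb] := qb _ Ox; rewrite ger0_norm ?powR_ge0//.
have -> : enorm (X x) = l^-1 * enorm (l *: X x).
  by rewrite enormZ// mulrA mulVf ?gt_eqF// mul1r.
rewrite powRM ?enorm_ge0 ?invr_ge0// ler_wpM2r ?powR_ge0//.
by rewrite powR_le_exponent// invr_ge0.
Qed.

Lemma W1_finite_modular q b u : measurable_fun Omega q ->
  (forall x, Omega x -> 0 < q x <= b) -> W1 Omega q u ->
  finite_modular mu Omega q (wgrad Omega u).
Proof.
move=> mq qb W1u; have [l l0 fl] := W1_finite_modularZ mq W1u.
exact: finite_modular_unscale mq qb l0 fl.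
Qed.

Lemma grad_finite_modular q b h : measurable_fun Omega q ->
  (forall x, Omega x -> 0 < q x <= b) -> test_fun Omega h ->
  finite_modular mu Omega q (grad h).
Proof.
move=> mq qb th; have mG := weak_grad_measurable (test_fun_is_weak_grad Omega_open th).
split => //; have [sh ch hO] := th.
have H i : exists B : R, forall x, `|partial i h x| <= B.
  apply: continuous_supp_bounded ch _; first exact/smooth_continuous/smooth_partial.
  by move=> x; exact: partial_supp.
have [B HB] := choice H.
pose C := Num.sqrt (\sum_i B i ^+ 2).
have hC x : enorm (grad h x) <= C.
  rewrite ler_wsqrtr// ler_sum// => i _; rewrite !mxE -expr2.
  rewrite -(real_normK (num_real (partial i h x))).
  by rewrite ler_pXn2r ?nnegrE ?HB// (le_trans _ (HB i x)).
apply: integrableR_le (integrable_cstR mO Omega_fin (1 + C `^ b)) _ => //.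
  exact: measurable_powR_enorm.
move=> x Ox; have /andP[q0 qxb] := qb _ Ox; rewrite ger0_norm ?powR_ge0//.
apply: (@le_trans _ _ (C `^ q x)).
  by rewrite ge0_ler_powR ?nnegrE ?enorm_ge0 ?sqrtr_ge0 ?hC// ltW.
by rewrite powR_le_exponent// sqrtr_ge0.
Qed.

Lemma Lq_norm_ge0 q u : (0 <= Lq_norm Omega q u)%E.
Proof.
apply/ereal_infP => _ [l [l0 _] <-].
by rewrite lee_fin ltW.
Qed.

(** The density of test functions in [W10], read off on the gradients. *)
Lemma W10_grad_approx q u G : measurable_fun Omega q -> W10 Omega q u ->
  is_weak_grad Omega u G -> forall e : R, 0 < e ->
  exists h l, [/\ test_fun Omega h, 0 < l, l <= e &
    (\int[mu]_(x in Omega) ((enorm (G x - grad h x) / l) `^ q x)%:E <= 1)%E].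
Proof.
move=> mq [W1u W10u] uG e e0; have [h th uh] := W10u e e0.
have hG := test_fun_is_weak_grad Omega_open th.
have uhG := is_weak_gradB Omega_open uG hG.
have ae := wgradB_ae Omega_open uG hG.
have {}uh : (Lq_norm Omega q (fun x => enorm (wgrad Omega (u \- h)%R x)) < e%:E)%E.
  by apply: le_lt_trans uh; rewrite leeDr// Lq_norm_ge0.
have [_ [l [l0 lM] <-]] := ereal_inf_lt uh; rewrite lte_fin => le.
exists h, l; split; [exact: th|exact: l0|exact: ltW|].
apply: le_trans lM; rewrite le_eqVlt; apply/orP; left; apply/eqP.
have M X : measurable_field Omega X ->
    measurable_fun Omega (fun x => (`|enorm (X x) / l| `^ q x)%:E).
  move=> mX; apply/measurable_EFinP/measurable_fun_powR2 => //.
  apply: measurableT_comp => //; apply: measurable_funM; last exact: measurable_cst.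
  exact: measurable_enorm.
have N (x : 'rV[R]_n) : enorm x / l = `|enorm x / l|.
  by rewrite ger0_norm// divr_ge0 ?enorm_ge0 ?ltW.
under eq_integral do rewrite N.
apply: ae_eq_integral => //.
- exact: (M _ (weak_grad_measurable uhG)).
- exact: (M _ (weak_grad_measurable (is_weak_grad_wgrad uhG))).
- by apply: filterS ae => x H Ox; rewrite H.
Qed.

End sobolev_modulars.

(** * Convergence of the solutions *)

Section exponents.
Context {R : realType} {n : nat}.
Variables (Omega : set 'rV[R]_n) (p_ : nat -> 'rV[R]_n -> R) (p : 'rV[R]_n -> R).

Lemma uniform_cvg_near : {uniform Omega, p_ @ \oo --> p} ->
  forall e : R, 0 < e -> exists N, forall i, (N <= i)%N ->
    forall x, Omega x -> `|p x - p_ i x| < e.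
Proof.
move=> pu e e0.
have : nbhs (p : {uniform` Omega -> R}) [set h : {uniform` Omega -> R} |
    forall x, Omega x -> ball (p x) e (h x)].
  apply/uniform_nbhs; exists [set xy | ball xy.1 e xy.2]; split => //.
  exact: (entourage_ball R (PosNum e0)).
by move=> /pu[N _ HN]; exists N => i Ni x Ox; exact: HN.
Qed.

Lemma continuous_closure_measurable (q : 'rV[R]_n -> R) : open Omega ->
  {within closure Omega, continuous q} -> measurable_fun Omega q.
Proof.
move=> oO cq; apply: (continuous_measurable_rV oO) => x Ox.
have := continuous_subspaceW (@subset_closure _ Omega) cq.
by rewrite continuous_open_subspace// => /(_ x); rewrite inE; exact.
Qed.

Lemma exponent_bounds : Omega !=set0 ->
  (1 < ereal_inf [set (p x)%:E | x in Omega])%E ->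
  (ereal_sup [set (p x)%:E | x in Omega] < +oo)%E ->
  exists a b : R, 1 < a /\ forall x, Omega x -> a <= p x <= b.
Proof.
move=> [x0 Ox0] inf1 supy.
have lb x : Omega x -> (ereal_inf [set (p x)%:E | x in Omega] <= (p x)%:E)%E.
  by move=> Ox; apply: ereal_inf_lbound; exists x.
have ub x : Omega x -> ((p x)%:E <= ereal_sup [set (p x)%:E | x in Omega])%E.
  by move=> Ox; apply: ereal_sup_ubound; exists x.
move: inf1 supy lb ub; case: ereal_inf => [a||]; case: ereal_sup => [b||] //.
- move=> a1 _ lb ub; exists a, b; split; first by rewrite -lte_fin.
  by move=> x Ox; rewrite -!lee_fin lb// ub.
- by move=> _ _ _ /(_ _ Ox0).
- by move=> _ _ /(_ _ Ox0).
- by move=> _ _ /(_ _ Ox0).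
Qed.

End exponents.

Unset Implicit Arguments.

Theorem theorem1p2 (R : realType) (n : nat) (Omega : set 'rV[R]_n)
    (p_ : nat -> 'rV[R]_n -> R) (p : 'rV[R]_n -> R)
    (phi : 'rV[R]_n -> R) (f : ('rV[R]_n -> R) -> R)
    (w_ : nat -> 'rV[R]_n -> R) (w : 'rV[R]_n -> R)
    (n_gt0 : (0 < n)%N)
    (Omega_domain : bounded_smooth_domain Omega)
    (p_cont : forall i, (1 <= i)%N -> {within closure Omega, continuous (p_ i)})
    (p_decr : forall i, (1 <= i)%N ->
       forall x, Omega x -> p_ i.+1 x <= p_ i x)
    (p_unif : {uniform Omega, p_ @ \oo --> p})
    (p_inf : (1 < ereal_inf [set (p x)%:E | x in Omega])%E)
    (p_sup : (ereal_sup [set (p x)%:E | x in Omega] < +oo)%E)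
    (phi_W1 : W1 Omega (p_ 1%N) phi)
    (f_dual : W10_dual Omega p f)
    (w_sol : dirichlet_solution Omega p f phi w)
    (w_i_sol : forall i, (1 <= i)%N ->
       dirichlet_solution Omega (p_ i) f phi (w_ i))
    (w_J : exists2 J, (1 <= J)%N &
       (\int[lebesgue_rV n]_(x in Omega)
          (enorm (wgrad Omega w x) `^ p_ J x)%:E < +oo)%E) :
  (fun i => \int[lebesgue_rV n]_(x in Omega)
     (enorm (wgrad Omega (w_ i \- w)%R x) `^ p x)%:E)%E @ \oo --> 0%E.
Proof.
have [oO _ O0 bO _] := Omega_domain.
have mO := open_measurable_rV oO.
have O_fin := bounded_finite mO bO.
have mp_ i : (1 <= i)%N -> measurable_fun Omega (p_ i).
  by move=> i1; exact: continuous_closure_measurable oO (p_cont i i1).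
have [a [b [a1 ab]]] := exponent_bounds O0 p_inf p_sup.
have p_cvg x : Omega x -> p_ ^~ x @ \oo --> p x.
  move=> Ox; apply/cvgrPdist_lt => e e0.
  have [N HN] := uniform_cvg_near p_unif e0.
  by exists N => // i /= Ni; exact: HN.
have p_mono i j x : (1 <= i)%N -> (i <= j)%N -> Omega x -> p_ j x <= p_ i x.
  move=> i1 /subnK <- Ox; elim: (j - i)%N => [//|k IH].
  by apply: le_trans IH; apply: p_decr => //; rewrite (leq_trans i1)// leq_addl.
have p_le i x : (1 <= i)%N -> Omega x -> p x <= p_ i x.
  move=> i1 Ox; apply/ler_addgt0Pr => e e0.
  have [N HN] := uniform_cvg_near p_unif e0.
  have := HN (maxn N i) (leq_maxl _ _) x Ox; rewrite ltr_distl => /andP[_].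
  by move=> /ltW/le_trans; apply; rewrite lerD2r p_mono// leq_maxr.
have [N HN] := uniform_cvg_near p_unif ltr01.
(* from [i0] on all exponents take their values in [[a, b + 1]] *)
pose i0 := maxn N 1; have i01 k : (1 <= k + i0)%N.
  by rewrite (leq_trans (leq_maxr N 1))// leq_addl.
pose q_ k := p_ (k + i0)%N.
have mq k : measurable_fun Omega (q_ k) by exact: mp_.
have q_cvg x : Omega x -> q_ ^~ x @ \oo --> p x.
  by move=> /p_cvg; rewrite -(cvg_shiftn i0).
have mp : measurable_fun Omega p by exact: measurable_fun_cvg mq q_cvg.
have ap x : Omega x -> a <= p x by move=> /ab/andP[].
have pb x : Omega x -> p x <= b by move=> /ab/andP[].
have p0 x : Omega x -> 0 < p x.
  by move=> /ap; apply: lt_le_trans; exact: lt_trans a1.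
have p1 x : Omega x -> 1 <= p x by move=> /ap; apply: le_trans; exact: ltW.
have pq k x : Omega x -> p x <= q_ k x <= q_ 0%N x.
  by move=> Ox; rewrite p_le// p_mono// ?(i01 0%N)// leq_addl.
have q0b x : Omega x -> q_ 0%N x <= b + 1.
  move=> Ox; have := HN (0 + i0)%N (leq_maxl _ _) x Ox.
  rewrite ltr_distlC => /andP[_ /ltW/le_trans]; apply.
  by rewrite lerD2r pb.
have q0 k x : Omega x -> 0 < q_ k x <= b + 1.
  move=> Ox; have /andP[pqk qk0] := pq k x Ox.
  by rewrite (lt_le_trans (p0 _ Ox) pqk) (le_trans qk0 (q0b _ Ox)).
have p0b x : Omega x -> 0 < p x <= b by move=> Ox; rewrite p0// pb.
pose W := wgrad Omega w; pose Phi := wgrad Omega phi.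
pose V_ k := wgrad Omega (w_ (k + i0)%N).
have [w_W1 w_W10 w_eq] := w_sol.
have wW : is_weak_grad Omega w W := W1_weak_grad w_W1.
have phiP : is_weak_grad Omega phi Phi := W1_weak_grad phi_W1.
have wV k : is_weak_grad Omega (w_ (k + i0)%N) (V_ k).
  by have [vW1 _ _] := w_i_sol _ (i01 k); exact: W1_weak_grad vW1.
have fW : finite_modular (lebesgue_rV n) Omega p W.
  exact: (W1_finite_modular oO mp p0b w_W1).
have fV k : finite_modular (lebesgue_rV n) Omega (q_ k) (V_ k).
  have [vW1 _ _] := w_i_sol _ (i01 k).
  exact: (W1_finite_modular oO (mq k) (q0 k) vW1).
have fPhi : finite_modular (lebesgue_rV n) Omega (q_ 0%N) Phi.
  (* the exponent is lowered to a bounded one before the factor is removed *)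
  have [l l0 fl] := W1_finite_modularZ oO (mp_ 1%N (leqnn _)) phi_W1.
  apply: (finite_modular_unscale oO (mq 0%N) (q0 0%N) l0).
  apply: (finite_modular_le mO O_fin (mq 0%N) _ fl) => x Ox.
  by have /andP[-> _] := q0 0%N x Ox; rewrite p_mono// (i01 0%N).
pose H : set ('rV[R]_n -> 'rV[R]_n) := [set grad h | h in test_fun Omega].
have fH k K : H K -> finite_modular (lebesgue_rV n) Omega (q_ k) K.
  by move=> [h th <-]; exact: (grad_finite_modular oO bO (mq k) (q0 k) th).
have eqH k K : H K -> \int[lebesgue_rV n]_(x in Omega) flux (p x) (W x) (K x) =
    \int[lebesgue_rV n]_(x in Omega) flux (q_ k x) (V_ k x) (K x).
  move=> [h th <-]; have [_ _ v_eq] := w_i_sol _ (i01 k).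
  by apply: oppr_inj; rewrite [LHS](w_eq h th) [RHS](v_eq h th).
have [||fVW conv] := @energy_convergence R _ _ n (lebesgue_rV n) Omega mO O_fin
  H p q_ a (b + 1) W Phi V_ a1 mp mq ap q0b pq q_cvg fW fPhi fV (fH 0%N).
(* density, the bound [l <= 1] giving [l `^ p x <= l] *)
- move=> e e0; pose d := minr e 1.
  have d0 : 0 < d by rewrite lt_min e0 ltr01.
  have [h [l [th l0 ld hM]]] := W10_grad_approx oO mp w_W10
    (is_weak_gradB oO wW phiP) d0.
  exists (grad h); first by exists h.
  have l1 : l <= 1 by rewrite (le_trans ld)// ge_min lexx orbT.
  pose U x := W x - Phi x - grad h x.
  have EU x : enorm (Phi x + grad h x - W x) = l * (enorm (U x) / l).
    rewrite mulrCA divff ?gt_eqF// mulr1 -enormN; congr enorm.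
    by rewrite /U opprB opprD addrA.
  have mU : measurable_field Omega U.
    exact: weak_grad_measurable (is_weak_gradB oO (is_weak_gradB oO wW phiP)
      (test_fun_is_weak_grad oO th)).
  have mUl : measurable_fun Omega (fun x => (enorm (U x) / l) `^ p x).
    apply: measurable_fun_powR2 => //.
    by apply: measurable_funM; [exact: measurable_enorm|exact: measurable_cst].
  have I : (\int[lebesgue_rV n]_(x in Omega)
      (enorm (Phi x + grad h x - W x) `^ p x)%:E <= l%:E)%E.
    apply: (@le_trans _ _ (\int[lebesgue_rV n]_(x in Omega)
        (l%:E * ((enorm (U x) / l) `^ p x)%:E))%E).
      apply: ge0_le_integral => //.
      - by move=> x _; rewrite lee_fin powR_ge0.
      - apply/measurable_EFinP; under eq_fun do rewrite EU.
        apply: measurable_fun_powR2 => //; apply: measurable_funM.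
          exact: measurable_cst.
        by apply: measurable_funM; [exact: measurable_enorm|exact: measurable_cst].
      - apply/measurable_EFinP/measurable_funM; last exact: mUl.
        exact: measurable_cst.
      - move=> x Ox; have Ul : 0 <= enorm (U x) / l.
          by rewrite divr_ge0 ?enorm_ge0// ltW.
        rewrite -EFinM lee_fin EU (powRM _ (ltW l0) Ul).
        by rewrite ler_wpM2r ?powR_ge0// ge1r_powR ?l0 ?p1.
    rewrite ge0_integralZl_EFin ?(ltW l0)//.
    - by rewrite -[leRHS]mule1 lee_pmul2l.
    - by move=> x _; rewrite lee_fin powR_ge0.
    - exact/measurable_EFinP.
  have I0 : (0 <= \int[lebesgue_rV n]_(x in Omega)
      (enorm (Phi x + grad h x - W x) `^ p x)%:E)%E.
    by apply: integral_ge0 => x _; rewrite lee_fin powR_ge0.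
  rewrite -lee_fin fineK; last by rewrite ge0_fin_numE// (le_lt_trans I)// ltry.
  by rewrite (le_trans I)// lee_fin (le_trans ld)// ge_min lexx.
(* [grad (h - h')] approximates [Phi + grad h - V_ k] as [grad h'] approximates
   [V_ k - Phi] *)
- move=> k _ [h th <-].
  refine (@flux_eq_closure R _ _ n (lebesgue_rV n) Omega mO O_fin H p (q_ k)
    (b + 1) W (V_ k) (fun x => Phi x + grad h x - V_ k x) mp (mq k) _ _ fW (fV k)
    _ (fH k) (eqH k) _).
  + by move=> x Ox; rewrite p1//; have /andP[->] := pq k x Ox.
  + by move=> x Ox; have /andP[_ ->] := q0 k x Ox.
  + apply: measurable_fieldB; last exact: weak_grad_measurable (wV k).
    apply: measurable_fieldD; first exact: weak_grad_measurable phiP.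
    exact: weak_grad_measurable (test_fun_is_weak_grad oO th).
  + move=> e e0; have [_ vW10 _] := w_i_sol _ (i01 k).
  have [h' [l [th' l0 le hM]]] := W10_grad_approx oO (mq k) vW10
    (is_weak_gradB oO (wV k) phiP) e0.
  exists (grad (h \- h')), l; split; [|exact: l0|exact: le|].
    by exists (h \- h'); [exact: test_funB|].
  have En x : enorm (Phi x + grad h x - V_ k x - grad (h \- h') x) =
      enorm (V_ k x - Phi x - grad h' x).
    have [[sh _ _] [sh' _ _]] := (th, th').
    rewrite -enormN gradB//; congr enorm.
    by apply/rowP => i; rewrite !mxE; ring.
  by under eq_integral do rewrite En.
rewrite -(cvg_shiftn i0).
have E k : (\int[lebesgue_rV n]_(x in Omega)
    (enorm (wgrad Omega (w_ (k + i0)%N \- w)%R x) `^ p x)%:E)%E =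
    (\int[lebesgue_rV n]_(x in Omega) enorm (V_ k x - W x) `^ p x)%:E.
  have [mVW iVW] := fVW k; rewrite /Rintegral fineK; last first.
    exact: integrable_fin_num iVW.
  have vw := is_weak_gradB oO (wV k) wW.
  apply: ae_eq_integral => //.
  - apply/measurable_EFinP/measurable_powR_enorm => //.
    exact: weak_grad_measurable (is_weak_grad_wgrad vw).
  - exact/measurable_EFinP/measurable_powR_enorm.
  - by apply: filterS (wgradB_ae oO (wV k) wW) => x Hx Ox; rewrite Hx.
rewrite [X in X @ _](_ : _ = fun k => (\int[lebesgue_rV n]_(x in Omega)
  enorm (V_ k x - W x) `^ p x)%:E); last by apply/funext => k; exact: E.
by apply: cvg_EFin; first exact: nearW.
Qed.
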